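(* Let $\alpha\ge 0$ and $\theta\in\bigl(0,\tfrac{1-\alpha+\sqrt{\alpha^2+6\alpha+5}}{2}\bigr)$. Let $T$, $Q$, $d_0$, the DR-ADMM and the DR-HPE framework be as defined in the context. Then the DR-ADMM is an instance of the DR-HPE framework for solving $0\in T(z)$, where one takes $z_0=(x_0,y_0,\gamma_0)$, $M=Q$, the same tolerance $\rho$, the iterates $z_k=(x_k,y_k,\gamma_k)$ and $\tilde z_k=(x_k,y_k,\tilde\gamma_k)$, and the parameters $\tau,\sigma,\eta_0$ as follows: (i) if $\theta\in(0,1)$: any $\tau\in(0,1)$, $\sigma=\theta+(\theta-1)^2$ and $\eta_0=0$; (ii) if $\theta\in\bigl[1,\tfrac{1-\alpha+\sqrt{\alpha^2+6\alpha+5}}{2}\bigr)$: $\tau=\bar\tau$, $\sigma=\bar\sigma$ and $\eta_0=\dfrac{4(\bar\sigma+\theta-1)d_0^2}{(2-\theta)(1-\bar\tau)}$, with $(\bar\tau,\bar\sigma)$ an admissible pair as defined in the context. As a consequence, the DR-ADMM terminates in at most $$\mathcal{O}\left(\left(1+\frac{d_0}{\rho}\right)\left[1+\log^+\left(\frac{d_0}{\rho}\right)\right]\right)$$ iterations (total number of executions of its step 1, over all values of $\mu$; the implied constant depends only on $\theta$ and $\alpha$), with an output $(x,y,\tilde\gamma,v^x,v^y,v^\gamma)$ satisfying $$Q\begin{pmatrix}v^x\\ v^y\\ v^\gamma\end{pmatrix}\in\begin{pmatrix}\partial f(x)-A^*\tilde\gamma\\ \partial g(y)-B^*\tilde\gamma\\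 Ax+By-b\end{pmatrix}\quad\text{and}\quad \|(v^x,v^y,v^\gamma)\|_Q\le\rho .$$
   Context: Notation. $\log^+(t)=\max\{\log t,0\}$ for $t>0$ (read as $0$ at $t=0$). For a symmetric positive semidefinite operator $H$ on a Euclidean space, $\|u\|_H=\sqrt{\langle Hu,u\rangle}$ (a seminorm). $A^*,B^*$ are adjoints and $\partial$ is the convex subdifferential. Problem. $f:\mathbb{R}^n\to\mathbb{R}$ and $g:\mathbb{R}^p\to\mathbb{R}$ are convex, $A\in\mathbb{R}^{m\times n}$, $B\in\mathbb{R}^{m\times p}$, $b\in\mathbb{R}^m$, and the problem is $\min\{f(x)+g(y): Ax+By=b\}$, whose solution set is assumed nonempty. On $\mathcal{Z}=\mathbb{R}^n\times\mathbb{R}^p\times\mathbb{R}^m$ define the maximal monotone operator $T(x,y,\gamma)=(\partial f(x)-A^*\gamma)\times(\partial g(y)-B^*\gamma)\times\{Ax+By-b\}$. Its zeros are the triples formed by a solution and an associated Lagrange multiplier. DR-ADMM. Data: $(x_0,y_0,\gamma_0)\in\mathcal{Z}$, $\beta>0$, $\theta>0$, $\rho>0$, $\alpha\ge0$, and symmetric positive semidefinite matrices $R\in\mathbb{R}^{n\times n}$, $S\in\mathbb{R}^{p\times p}$. (0) Set $\mu=1$, $k=1$. (1) Set $\beta_1=\beta\theta/(\theta+\mu)$, $\beta_2=\beta(1+\mu)$, $\hat x_{k-1}=(x_{k-1}+\mu x_0)/(1+\mu)$, $\hat\gamma_{k-1}=(\theta\gamma_{k-1}+\mu\gamma_0)/(\theta+\mu)$,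 and compute $x_k\in\operatorname{argmin}_x\{f(x)-\langle\hat\gamma_{k-1},Ax\rangle+\frac{\beta_1}{2}\|Ax+By_{k-1}-b\|^2+\frac{1+\mu}{2}\|x-\hat x_{k-1}\|_R^2\}$. (2) Set $\tilde\gamma_k=\hat\gamma_{k-1}-\beta_1(Ax_k+By_{k-1}-b)$, $\hat y_{k-1}=(y_{k-1}+\mu y_0)/(1+\mu)$, $u_k=\tilde\gamma_k+\beta_2(Ax_k+B\hat y_{k-1}-b)$, and compute $y_k\in\operatorname{argmin}_y\{g(y)-\langle u_k,By\rangle+\frac{\beta_2}{2}[\|Ax_k+By-b\|^2+\alpha\|B(y-\hat y_{k-1})\|^2+\frac1\beta\|y-\hat y_{k-1}\|_S^2]\}$, $\gamma_k=\gamma_{k-1}-\theta\beta[Ax_k+By_k-b+\mu(\tilde\gamma_k-\gamma_0)/(\beta\theta)]$. (3) Let $\Delta x_k=x_{k-1}-x_k$, $\Delta y_k=y_{k-1}-y_k$, $\Delta\gamma_k=\gamma_{k-1}-\gamma_k$. If $(\|\Delta x_k\|_R^2+(1+\alpha)\beta\|B\Delta y_k\|^2+\|\Delta y_k\|_S^2+\frac{1}{\beta\theta}\|\Delta\gamma_k\|^2)^{1/2}\le\rho/2$ go to (4); otherwise set $k\leftarrow k+1$ and go to (1). (4) Set $v^x_k=\Delta x_k-\mu(x_k-x_0)$, $v^y_k=\Delta y_k-\mu(y_k-y_0)$, $v^\gamma_k=\Delta\gamma_k-\mu(\tilde\gamma_k-\gamma_0)$. If $(\|v^x_k\|_R^2+(1+\alpha)\beta\|Bv^y_k\|^2+\|v^y_k\|_S^2+\frac1{\beta\theta}\|v^\gamma_k\|^2)^{1/2}\le\rho$,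 stop and output $(x,y,\tilde\gamma,v^x,v^y,v^\gamma)=(x_k,y_k,\tilde\gamma_k,v^x_k,v^y_k,v^\gamma_k)$; otherwise set $\mu\leftarrow\mu/2$, $k=1$ and go to (1) (restarting from $(x_0,y_0,\gamma_0)$). The minimizers in (1) and (2) are assumed to exist; $x_k,y_k$ may be any of them. Operator $Q$ and $d_0$. $Q:\mathcal{Z}\to\mathcal{Z}$ is block diagonal with blocks $R$, $(1+\alpha)\beta B^*B+S$, $(\theta\beta)^{-1}I$. With $z_0=(x_0,y_0,\gamma_0)$, it is assumed that for every $\mu>0$ the set $\{z\in\mathcal{Z}:0\in T(z)+\mu Q(z-z_0)\}$ is nonempty. $d_0=\inf\{\|z_0-z\|_Q:0\in T(z)\}$. DR-HPE framework for $0\in T(z)$, with $T$ maximal monotone on a finite-dimensional inner product space $\mathcal{Z}$ and $T^{-1}(0)\neq\emptyset$. (0) Given $z_0\in\mathcal{Z}$, $\eta_0\ge0$, $\sigma\in[0,1)$, $\tau\in(0,1)$, $\rho>0$, and a selfadjoint positive semidefinite $M$ on $\mathcal{Z}$, set $\mu=1$, $k=1$. (1) Find $(z_k,\tilde z_k,\eta_k)\in\mathcal{Z}\times\mathcal{Z}\times\mathbb{R}_+$ with $M(z_{k-1}-z_k)\in T(\tilde z_k)+\mu M(\tilde z_k-z_0)$ and $\|z_k-\tilde z_k\|_M^2+\eta_k\le\sigma\|z_{k-1}-\tilde z_k\|_M^2+(1-\tau)\eta_{k-1}$. (2) If $\|z_{k-1}-z_k\|_M\le\rho/2$ go to (3);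 otherwise set $k\leftarrow k+1$ and go to (1). (3) Let $v_k=z_{k-1}-z_k-\mu(\tilde z_k-z_0)$. If $\|v_k\|_M\le\rho$, stop and output $(\tilde z_k,v_k)$; otherwise set $\mu\leftarrow\mu/2$, $k=1$ and go to (1). The DR-ADMM being an instance of this framework means that the parameters are admissible in step (0), that its iterates (with suitable $\eta_k\ge0$, $k\geq 1$) satisfy the requirements of step (1), and that its steps (3), (4) are steps (2), (3) of the framework. Admissible pair $(\bar\tau,\bar\sigma)$ (for $\theta\in[1,\frac{1-\alpha+\sqrt{\alpha^2+6\alpha+5}}{2})$): $\bar\tau\in(0,1/2)$ is a number such that, with $\mathsf a=(1-\bar\tau)(1+\alpha)(1+\theta)-\alpha-(1-\theta)^2$, $\mathsf b=[(1-\bar\tau)(1+\alpha)(1+\theta)-\alpha-2(1-\theta)](1-\theta)^2-\alpha\bar\tau(1-\theta)+1-\bar\tau$, $\mathsf c=[1-\bar\tau-\alpha\bar\tau(1-\theta)-(1-\theta)^2](1-\theta)^2$, the number $\bar\sigma=\frac{\mathsf b+\sqrt{\mathsf b^2-4\mathsf a\mathsf c}}{2\mathsf a}$ is well defined and lies in $(0,1)$, one has $\max\{(1-\theta)^2,\ \frac{\bar\tau(\theta-1)}{(1-\bar\tau)\theta-\bar\tau},\ \frac{1-\bar\tau[1+\alpha(1-\theta)]}{(1-\bar\tau)(1+\alpha)(1+\theta)-\alpha}\}\le\bar\sigma$, and the symmetric $2\times2$ matrix $G$ with entries $G_{11}=(1-\bar\tau)[\bar\sigma(1+\theta)-1]+\alpha[\theta\bar\sigma-\bar\tau(\bar\sigma+\theta+\bar\sigma\theta-1)]$,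 $G_{12}=G_{21}=(\bar\sigma+\theta-1)(1-\theta)$, $G_{22}=\bar\sigma-(1-\theta)^2$ is positive semidefinite. Such a pair exists for every such $\alpha,\theta$, and one such pair is fixed for each $(\alpha,\theta)$. *)

(* Defs.v *)
From HB Require Import structures.
From mathcomp Require Import all_boot all_order all_algebra.
From mathcomp Require Import all_classical all_reals all_analysis.

Set Implicit Arguments.
Unset Strict Implicit.
Unset Printing Implicit Defensive.

Import Order.TTheory GRing.Theory Num.Theory.

Local Open Scope classical_set_scope.
Local Open Scope ring_scope.

(* Both algorithms are loops that read a configuration, compute an iterate
   (possibly any of several), and then either stop or move on to a new
   configuration.  [step] is one execution of step (1) of the framework,
   respectively of steps (1)-(2) of the ADMM. *)
Record algorithm (C S : Type) := Algorithm {
  start : C;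
  step : C -> S -> Prop;
  stop : C -> S -> bool;
  next : C -> S -> C }.

(* [c i] and [s i] are the configuration and the iterate of the (i+1)-st
   execution of [step], counted across all restarts.  Every [step] that the
   algorithm has to perform succeeds; the values of [c] and [s] after the
   algorithm has stopped are unconstrained. *)
Definition execution (C S : Type) (a : algorithm C S)
    (c : nat -> C) (s : nat -> S) : Prop :=
  c 0%N = start a /\
  forall i : nat, (forall j : nat, (j < i)%N -> ~~ stop a (c j) (s j)) ->
    step a (c i) (s i) /\
    (~~ stop a (c i) (s i) -> c i.+1 = next a (c i) (s i)).

Definition stops_at (C S : Type) (a : algorithm C S)
    (c : nat -> C) (s : nat -> S) (N : nat) : Prop :=
  stop a (c N) (s N) /\ forall j : nat, (j < N)%N -> ~~ stop a (c j) (s j).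

Section InnerProductSpace.
Context {R : realType} {V : vectType R}.
Variable ip : {dot V for (@idfun R)}.

Definition seminorm (H : V -> V) (u : V) : R := Num.sqrt (ip (H u) u).

Definition selfadjoint_psd (H : V -> V) : Prop :=
  [/\ linear H, forall u v, ip (H u) v = ip u (H v) &
      forall u, 0 <= ip (H u) u].

Implicit Type T : V -> set V.

Definition monotone T : Prop :=
  forall u v a b, T u a -> T v b -> 0 <= ip (u - v) (a - b).

Definition maximal_monotone T : Prop :=
  monotone T /\
  forall T', monotone T' -> (forall u, T u `<=` T' u) ->
    forall u, T' u `<=` T u.

Definition zeros T : set V := [set z | T z 0].

(* z |-> T(z) + mu M(z - z0) *)
Definition regularize T (mu : R) (M : V -> V) (z0 : V) : V -> set V :=
  fun z => [set w + mu *: M (z - z0) | w in T z].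

End InnerProductSpace.

(* mu, z_{k-1}, eta_{k-1} *)
Record hpe_config (R V : Type) := HpeConfig {
  hpe_mu : R; hpe_zprev : V; hpe_etaprev : R }.

(* z_k, \tilde z_k, eta_k *)
Record hpe_iterate (R V : Type) := HpeIterate {
  hpe_z : V; hpe_zt : V; hpe_eta : R }.

Section DRHPE.
Context {R : realType} {V : vectType R}.
Variables (ip : {dot V for (@idfun R)}) (T : V -> set V).
Variables (M : V -> V) (z0 : V) (eta0 sigma tau rho : R).

Record hpe_admissible : Prop := HpeAdmissible {
  hpe_maximal : maximal_monotone ip T;
  hpe_zeros : zeros T !=set0;
  hpe_eta0_ge0 : 0 <= eta0;
  hpe_sigma_bounds : 0 <= sigma < 1;
  hpe_tau_bounds : 0 < tau < 1;
  hpe_rho_gt0 : 0 < rho;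
  hpe_psd : selfadjoint_psd ip M }.

Implicit Types (c : hpe_config R V) (i : hpe_iterate R V).

Definition hpe_step c i : Prop :=
  [/\ regularize T (hpe_mu c) M z0 (hpe_zt i) (M (hpe_zprev c - hpe_z i)),
      0 <= hpe_eta i &
      seminorm ip M (hpe_z i - hpe_zt i) ^+ 2 + hpe_eta i <=
      sigma * seminorm ip M (hpe_zprev c - hpe_zt i) ^+ 2
        + (1 - tau) * hpe_etaprev c].

Definition hpe_test2 c i : bool :=
  seminorm ip M (hpe_zprev c - hpe_z i) <= rho / 2.

Definition hpe_v c i : V :=
  hpe_zprev c - hpe_z i - hpe_mu c *: (hpe_zt i - z0).

Definition hpe_test3 c i : bool := seminorm ip M (hpe_v c i) <= rho.

Definition hpe_next c i : hpe_config R V :=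
  if hpe_test2 c i then HpeConfig (hpe_mu c / 2) z0 eta0
  else HpeConfig (hpe_mu c) (hpe_z i) (hpe_eta i).

Definition dr_hpe : algorithm (hpe_config R V) (hpe_iterate R V) :=
  {| start := HpeConfig 1 z0 eta0;
     step := hpe_step;
     stop := fun c i => hpe_test2 c i && hpe_test3 c i;
     next := hpe_next |}.

End DRHPE.

Section Euclidean.
Context {R : realType}.

Section OneSpace.
Context {n : nat}.
Implicit Types (u v : 'cV[R]_n) (H : 'M[R]_n) (f : 'cV[R]_n -> R).

Definition dotv u v : R := (u^T *m v) 0 0.

Lemma dotvE u v : dotv u v = \sum_i u i 0 * v i 0.
Proof. by rewrite /dotv mxE; apply: eq_bigr => i _; rewrite mxE. Qed.

Lemma dotvC u v : dotv u v = dotv v u.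
Proof. by rewrite !dotvE; apply: eq_bigr => i _; rewrite mulrC. Qed.

Lemma dotv_linearl v a u u' :
  dotv (a *: u + u') v = a * dotv u v + dotv u' v.
Proof. by rewrite /dotv linearP mulmxDl -scalemxAl !mxE. Qed.

Lemma dotv_linearr u a v v' :
  dotv u (a *: v + v') = a * dotv u v + dotv u v'.
Proof. by rewrite dotvC dotv_linearl !(dotvC _ u). Qed.

HB.instance Definition _ :=
  isBilinear.Build R 'cV[R]_n 'cV[R]_n R *%R (@idfun R \; *%R) dotv
    (fun v => zmod_morphism_linear (dotv_linearl v))
    (fun u => zmod_morphism_linear (dotv_linearr u))
    (fun v => scalable_linear (dotv_linearl v))
    (fun u => scalable_linear (dotv_linearr u)).

Lemma dotv_hermitian u v :
  dotv u v = (-1) ^+ false * (@idfun R) (dotv v u).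
Proof. by rewrite expr0 mul1r dotvC. Qed.

HB.instance Definition _ :=
  isHermitianSesquilinear.Build R 'cV[R]_n false (@idfun R) dotv
    dotv_hermitian.

Lemma dotv_ge0 u : 0 <= dotv u u.
Proof. by rewrite dotvE sumr_ge0// => i _; rewrite -expr2 sqr_ge0. Qed.

Lemma dotv_gt0 u : u != 0 -> 0 < dotv u u.
Proof.
rewrite lt0r dotv_ge0 andbT; apply: contra => /eqP; rewrite dotvE => /eqP.
rewrite psumr_eq0 => [/allP u0|i _]; last by rewrite -expr2 sqr_ge0.
apply/eqP/matrixP => i j; rewrite ord1 mxE.
by have := u0 i (mem_index_enum _); rewrite mulf_eq0 orbb => /eqP.
Qed.

HB.instance Definition _ :=
  isDotProduct.Build R 'cV[R]_n dotv dotv_gt0.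

(* The library's norm on matrices is the sup norm, hence this one. *)
Definition norm2 u : R := Num.sqrt (dotv u u).

Definition mxnorm H u : R := seminorm dotv (mulmx H) u.

Definition mxpsd H : Prop := H^T = H /\ forall u, 0 <= dotv (H *m u) u.

Definition subdiff f u : set 'cV[R]_n :=
  [set s | forall v, f u + dotv s (v - u) <= f v].

Definition argmin (F : 'cV[R]_n -> R) : set 'cV[R]_n :=
  [set u | forall v, F u <= F v].

End OneSpace.
End Euclidean.

Notation Zspace R n p m := ('cV[R]_n * 'cV[R]_p * 'cV[R]_m)%type.

Section ProductSpace.
Context {R : realType} {n p m : nat}.
Implicit Types z w : Zspace R n p m.

Definition dotZ z w : R :=
  dotv z.1.1 w.1.1 + dotv z.1.2 w.1.2 + dotv z.2 w.2.

Lemma dotZC z w : dotZ z w = dotZ w z.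
Proof.
by rewrite /dotZ (dotvC z.1.1) (dotvC z.1.2) (dotvC z.2).
Qed.

Lemma dotZ_linearl w a z z' :
  dotZ (a *: z + z') w = a * dotZ z w + dotZ z' w.
Proof.
rewrite /dotZ /= !dotv_linearl !mulrDr.
by rewrite [X in X + _ = _]addrACA [LHS]addrACA.
Qed.

Lemma dotZ_linearr z a w w' :
  dotZ z (a *: w + w') = a * dotZ z w + dotZ z w'.
Proof. by rewrite dotZC dotZ_linearl !(dotZC _ z). Qed.

HB.instance Definition _ :=
  isBilinear.Build R (Zspace R n p m) (Zspace R n p m) R *%R (@idfun R \; *%R) dotZ
    (fun v => zmod_morphism_linear (dotZ_linearl v))
    (fun u => zmod_morphism_linear (dotZ_linearr u))
    (fun v => scalable_linear (dotZ_linearl v))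
    (fun u => scalable_linear (dotZ_linearr u)).

Lemma dotZ_hermitian z w :
  dotZ z w = (-1) ^+ false * (@idfun R) (dotZ w z).
Proof. by rewrite expr0 mul1r dotZC. Qed.

HB.instance Definition _ :=
  isHermitianSesquilinear.Build R (Zspace R n p m) false (@idfun R) dotZ
    dotZ_hermitian.

Lemma dotZ_gt0 z : z != 0 -> 0 < dotZ z z.
Proof.
move=> z0; rewrite lt0r !addr_ge0 ?dotv_ge0// andbT.
apply: contra z0; rewrite paddr_eq0 ?addr_ge0 ?dotv_ge0//.
rewrite paddr_eq0 ?dotv_ge0// => /andP[/andP[]].
case: z => [[x y] g] /= x0 y0 g0.
have dotv_eq0 k (u : 'cV[R]_k) : dotv u u == 0 -> u = 0.
  by move=> u0; apply/eqP; apply: contraTT u0 => /dotv_gt0 /gt_eqF ->.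
by rewrite (dotv_eq0 _ _ x0) (dotv_eq0 _ _ y0) (dotv_eq0 _ _ g0).
Qed.

HB.instance Definition _ :=
  isDotProduct.Build R (Zspace R n p m) dotZ dotZ_gt0.

End ProductSpace.

(* [dotZ] with its structure, the ambient vectType being made explicit to
   help unification *)
Definition ipZ (R : realType) (n p m : nat) :
  {dot (Zspace R n p m : vectType R) for (@idfun R)} := dotZ.

(* min { f x + g y : A x + B y = b } *)
Record problem (R : realType) (n p m : nat) := Problem {
  obj_f : 'cV[R]_n -> R;
  obj_g : 'cV[R]_p -> R;
  mat_A : 'M[R]_(m, n);
  mat_B : 'M[R]_(m, p);
  rhs_b : 'cV[R]_m }.

Record parameters (R : realType) (n p m : nat) := AdmmParameters {
  par_x0 : 'cV[R]_n;
  par_y0 : 'cV[R]_p;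
  par_gamma0 : 'cV[R]_m;
  par_beta : R;
  par_theta : R;
  par_rho : R;
  par_alpha : R;
  par_R : 'M[R]_n;
  par_S : 'M[R]_p }.

(* mu, x_{k-1}, y_{k-1}, gamma_{k-1} *)
Record admm_config (R : realType) (n p m : nat) := AdmmConfig {
  admm_mu : R;
  admm_xprev : 'cV[R]_n;
  admm_yprev : 'cV[R]_p;
  admm_gammaprev : 'cV[R]_m }.

(* x_k, y_k, \tilde\gamma_k, gamma_k *)
Record admm_iterate (R : realType) (n p m : nat) := AdmmIterate {
  admm_x : 'cV[R]_n;
  admm_y : 'cV[R]_p;
  admm_gammat : 'cV[R]_m;
  admm_gamma : 'cV[R]_m }.

Section DRADMM.
Context {R : realType} {n p m : nat}.
Variables (P : problem R n p m) (D : parameters R n p m).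

Let Z := Zspace R n p m.

Let f := obj_f P.
Let g := obj_g P.
Let A := mat_A P.
Let B := mat_B P.
Let b := rhs_b P.

Let x0 := par_x0 D.
Let y0 := par_y0 D.
Let gamma0 := par_gamma0 D.
Let beta := par_beta D.
Let theta := par_theta D.
Let rho := par_rho D.
Let alpha := par_alpha D.
Let MR := par_R D.
Let MS := par_S D.

Definition solutions : set ('cV[R]_n * 'cV[R]_p) :=
  [set w | A *m w.1 + B *m w.2 = b /\
    forall x y, A *m x + B *m y = b -> f w.1 + g w.2 <= f x + g y].

Definition opT : Z -> set Z := fun '(x, y, gamma) =>
  [set s - A^T *m gamma | s in subdiff f x] `*`
  [set s - B^T *m gamma | s in subdiff g y] `*`
  [set A *m x + B *m y - b].

Definition opQ (z : Z) : Z :=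
  (MR *m z.1.1,
   (((1 + alpha) * beta) *: (B^T *m B) + MS) *m z.1.2,
   (theta * beta)^-1 *: z.2).

Definition startZ : Z := (x0, y0, gamma0).

Definition d0 : R := inf [set seminorm (ipZ R n p m) opQ (startZ - z) | z in zeros opT].

Record standing_assumptions : Prop := StandingAssumptions {
  f_convex : convex_function (setT : set 'cV[R]_n) f;
  g_convex : convex_function (setT : set 'cV[R]_p) g;
  solvable : solutions !=set0;
  beta_gt0 : 0 < beta;
  theta_gt0 : 0 < theta;
  rho_gt0 : 0 < rho;
  alpha_ge0 : 0 <= alpha;
  R_psd : mxpsd MR;
  S_psd : mxpsd MS;
  regularized_solvable : forall mu : R, 0 < mu ->
    zeros (regularize opT mu opQ startZ) !=set0 }.

Implicit Types (c : admm_config R n p m) (i : admm_iterate R n p m).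

Definition admm_step c i : Prop :=
  let mu := admm_mu c in
  let xp := admm_xprev c in
  let yp := admm_yprev c in
  let gp := admm_gammaprev c in
  let x := admm_x i in
  let y := admm_y i in
  let gt := admm_gammat i in
  let beta1 := beta * theta / (theta + mu) in
  let beta2 := beta * (1 + mu) in
  let xh := (1 + mu)^-1 *: (xp + mu *: x0) in
  let gh := (theta + mu)^-1 *: (theta *: gp + mu *: gamma0) in
  let yh := (1 + mu)^-1 *: (yp + mu *: y0) in
  let u := gt + beta2 *: (A *m x + B *m yh - b) in
  [/\ argmin (fun x' : 'cV[R]_n =>
        f x' - dotv gh (A *m x')
        + beta1 / 2 * norm2 (A *m x' + B *m yp - b) ^+ 2
        + (1 + mu) / 2 * mxnorm MR (x' - xh) ^+ 2) x,
      gt = gh - beta1 *: (A *m x + B *m yp - b),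
      argmin (fun y' : 'cV[R]_p =>
        g y' - dotv u (B *m y')
        + beta2 / 2 * (norm2 (A *m x + B *m y' - b) ^+ 2
                       + alpha * norm2 (B *m (y' - yh)) ^+ 2
                       + beta^-1 * mxnorm MS (y' - yh) ^+ 2)) y &
      admm_gamma i = gp - (theta * beta) *:
        (A *m x + B *m y - b + (mu / (beta * theta)) *: (gt - gamma0))].

(* The quantity compared with rho/2 and with rho in the two tests. *)
Definition admm_residual (u : 'cV[R]_n) (v : 'cV[R]_p) (w : 'cV[R]_m) : R :=
  Num.sqrt (mxnorm MR u ^+ 2 + (1 + alpha) * beta * norm2 (B *m v) ^+ 2
            + mxnorm MS v ^+ 2 + (beta * theta)^-1 * norm2 w ^+ 2).

Definition admm_dx c i := admm_xprev c - admm_x i.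
Definition admm_dy c i := admm_yprev c - admm_y i.
Definition admm_dgamma c i := admm_gammaprev c - admm_gamma i.

Definition admm_test3 c i : bool :=
  admm_residual (admm_dx c i) (admm_dy c i) (admm_dgamma c i) <= rho / 2.

Definition admm_vx c i := admm_dx c i - admm_mu c *: (admm_x i - x0).
Definition admm_vy c i := admm_dy c i - admm_mu c *: (admm_y i - y0).
Definition admm_vgamma c i :=
  admm_dgamma c i - admm_mu c *: (admm_gammat i - gamma0).

Definition admm_test4 c i : bool :=
  admm_residual (admm_vx c i) (admm_vy c i) (admm_vgamma c i) <= rho.

Definition admm_next c i : admm_config R n p m :=
  if admm_test3 c i then AdmmConfig (admm_mu c / 2) x0 y0 gamma0
  else AdmmConfig (admm_mu c) (admm_x i) (admm_y i) (admm_gamma i).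

Definition dr_admm : algorithm (admm_config R n p m) (admm_iterate R n p m) :=
  {| start := AdmmConfig 1 x0 y0 gamma0;
     step := admm_step;
     stop := fun c i => admm_test3 c i && admm_test4 c i;
     next := admm_next |}.

Definition hpe_config_of c (etaprev : R) : hpe_config R Z :=
  HpeConfig (admm_mu c)
    (admm_xprev c, admm_yprev c, admm_gammaprev c) etaprev.

Definition hpe_iterate_of i (eta : R) : hpe_iterate R Z :=
  HpeIterate (admm_x i, admm_y i, admm_gamma i)
    (admm_x i, admm_y i, admm_gammat i) eta.

Definition instance_of_dr_hpe (tau sigma eta0 : R) : Prop :=
  [/\ hpe_admissible (ipZ R n p m) opT opQ eta0 sigma tau rho,
      forall (c : nat -> admm_config R n p m) (s : nat -> admm_iterate R n p m),
        execution dr_admm c s ->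
        exists etaprev eta : nat -> R,
          execution (dr_hpe (ipZ R n p m) opT opQ startZ eta0 sigma tau rho)
            (fun k => hpe_config_of (c k) (etaprev k))
            (fun k => hpe_iterate_of (s k) (eta k)) &
      forall c i etaprev eta,
        let hc := hpe_config_of c etaprev in
        let hi := hpe_iterate_of i eta in
        [/\ admm_test3 c i = hpe_test2 (ipZ R n p m) opQ rho hc hi,
            (admm_vx c i, admm_vy c i, admm_vgamma c i) = hpe_v startZ hc hi &
            admm_test4 c i = hpe_test3 (ipZ R n p m) opQ startZ rho hc hi]].

End DRADMM.

Section AdmissiblePair.
Context {R : realType}.
Variables alpha theta tau sigma : R.

Definition theta_sup : R :=
  (1 - alpha + Num.sqrt (alpha ^+ 2 + 6 * alpha + 5)) / 2.

Definition pair_a : R :=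
  (1 - tau) * (1 + alpha) * (1 + theta) - alpha - (1 - theta) ^+ 2.

Definition pair_b : R :=
  ((1 - tau) * (1 + alpha) * (1 + theta) - alpha - 2 * (1 - theta))
    * (1 - theta) ^+ 2
  - alpha * tau * (1 - theta) + 1 - tau.

Definition pair_c : R :=
  (1 - tau - alpha * tau * (1 - theta) - (1 - theta) ^+ 2)
    * (1 - theta) ^+ 2.

Definition pair_G : 'M[R]_2 :=
  \matrix_(i, j)
    if i != j then (sigma + theta - 1) * (1 - theta)
    else if i == 0 then
      (1 - tau) * (sigma * (1 + theta) - 1)
      + alpha * (theta * sigma
                 - tau * (sigma + theta + sigma * theta - 1))
    else sigma - (1 - theta) ^+ 2.

(* [pair_a_neq0] and [pair_discr] say that the formula for sigma is well
   defined: division by 0 and square roots of negative numbers are total. *)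
Record admissible_pair : Prop := AdmissiblePair {
  pair_tau : 0 < tau < 1 / 2;
  pair_a_neq0 : pair_a != 0;
  pair_discr : 0 <= pair_b ^+ 2 - 4 * pair_a * pair_c;
  pair_sigma : sigma =
    (pair_b + Num.sqrt (pair_b ^+ 2 - 4 * pair_a * pair_c)) / (2 * pair_a);
  pair_sigma01 : 0 < sigma < 1;
  pair_max :
    Num.max ((1 - theta) ^+ 2)
      (Num.max (tau * (theta - 1) / ((1 - tau) * theta - tau))
         ((1 - tau * (1 + alpha * (1 - theta)))
            / ((1 - tau) * (1 + alpha) * (1 + theta) - alpha))) <= sigma;
  pair_G_psd : mxpsd pair_G }.

End AdmissiblePair.

(* The library's [ln] vanishes on nonpositive numbers, so [logplus 0 = 0]. *)
Definition logplus {R : realType} (t : R) : R := Num.max (ln t) 0.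

(* Main.v *)
Require Import Defs.
From mathcomp Require Import all_boot all_order all_algebra.
From mathcomp Require Import all_classical all_reals all_analysis.
From mathcomp Require Import ring lra.
Import Order.TTheory GRing.Theory Num.Theory.
Local Open Scope classical_set_scope.
Local Open Scope ring_scope.
Set Implicit Arguments.
Unset Strict Implicit.

(** Why the theorem is true.

    T is the subdifferential of a finite convex separable function plus a skew
    affine map.  A finite convex function on a Euclidean space has a
    subgradient everywhere, and at a minimizer over an affine subspace it has
    one that is a combination of the constraints (multiplier_exists).  This
    makes T maximal monotone and produces zeros of T from solutions.

    Instance.  The optimality conditions of the two subproblems and the
    multiplier update say exactly that
    Q(z_{k-1} - z_k) lies in T(zt_k) + mu Q(zt_k - z_0)   (admm_inclusion),
    so that only the error criterion is at stake.  Put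
    a = B(y_{k-1} - y_k) and w = (gamma_{k-1} - gamma_k) / (beta theta).  Then
    gamma_{k-1} - gammat_k = beta (w + a) and
    gamma_k - gammat_k = beta ((1 - theta) w + a), and the criterion becomes a
    scalar inequality in |w|^2, <w, a>, |a|^2 (error_criterion_gap).
    - For theta < 1 and the given sigma its two sides differ by nonnegative
      terms, one of them a multiple of |w + theta a|^2.
    - For theta >= 1 a lower bound on <w, a> is needed.  Monotonicity of the
      subdifferential of g between two consecutive iterates gives one
      (coupling), in terms of the previous w and a.  The error eta_k absorbs
      what telescopes, and what remains is the quadratic form of the matrix G,
      taken at a and (1 - tau) times the previous w (next_gap).
      The first iteration of a cycle has no predecessor: there the distance
      from z_0 to the zero of the regularized operator, which is at most d_0,
      plays that part (first_step_gap), and this is where eta_0 comes from.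

    Complexity.  It holds for the abstract framework (dr_hpe_complexity).
    Inside a cycle let z* be a zero of T + mu M(. - z_0) and
    E_k = |z* - z_k|^2 + eta_k.  Strong monotonicity makes E_k shrink by a
    factor 1 - c mu at each iteration, and the first test succeeds once E is
    below a multiple of rho^2; so a cycle takes
    O(1 + log+(d_0 / rho) / mu) iterations.  A cycle can fail the second test
    only if mu d_0 exceeds a multiple of rho; so the values of 1 / mu, which
    double, have a sum of order 1 + d_0 / rho.  A single potential, decreasing
    by 1 at each iteration, does both counts (potential_step).

    The constants depend on sigma, tau and theta only.  For theta >= 1 a pair
    exists since the form of G tends, for (tau, sigma) -> (0, 1), to a
    positive definite one exactly when theta is below theta_sup
    (relaxation_pair_exists). *)

(** * Sublinear functions and linear minorants *)

Section Sublinear.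
Context {R : realType} {E : lmodType R}.
Implicit Types (p : E -> R) (u v e : E).

Record sublinear p : Prop := Sublinear {
  sublinD : forall u v, p (u + v) <= p u + p v;
  sublinZ : forall c u, 0 <= c -> p (c *: u) = c * p u }.

Lemma sublin0 p : sublinear p -> p 0 = 0.
Proof. by case=> _ pZ; rewrite -(scale0r (0 : E)) pZ// mul0r. Qed.

Lemma sublin_ge_opp p u : sublinear p -> - p (- u) <= p u.
Proof.
by move=> sp; have := sublinD sp u (- u); rewrite subrr (sublin0 sp); lra.
Qed.

Lemma inf_le_elem (S : set R) c x : (forall y, S y -> c <= y) -> S x -> inf S <= x.
Proof. by move=> Sc Sx; apply: ge_inf => //; exists c. Qed.

(** The largest sublinear function below p that takes the value p e at e and is
    additive in that direction: doing this for each vector of a basis turns p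
    into a linear function. *)
Definition sublin_along p e v : R :=
  inf [set p (v + t *: e) - t * p e | t in [set t : R | 0 <= t]].

Lemma sublin_along_bound p e v : sublinear p ->
  forall y, [set p (v + t *: e) - t * p e | t in [set t : R | 0 <= t]] y ->
  - p (- v) <= y.
Proof.
move=> sp _ [t t0 <-]; have := sublinD sp (v + t *: e) (- v).
by rewrite addrC addKr (sublinZ sp)//; lra.
Qed.

Lemma sublin_along_le p e v t : sublinear p -> 0 <= t ->
  sublin_along p e v <= p (v + t *: e) - t * p e.
Proof.
by move=> sp t0; apply: inf_le_elem (sublin_along_bound sp) _; exists t.
Qed.

Lemma sublin_along_leW p e v : sublinear p -> sublin_along p e v <= p v.
Proof.
move=> sp; have := sublin_along_le e v sp (lexx 0).
by rewrite scale0r addr0 mul0r subr0.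
Qed.

Lemma sublin_along_ge p e v c :
  (forall t, 0 <= t -> c <= p (v + t *: e) - t * p e) -> c <= sublin_along p e v.
Proof.
move=> H; apply: lb_le_inf; first by exists (p (v + 0 *: e) - 0 * p e), 0 => //=.
by move=> _ [t t0 <-]; apply: H.
Qed.

Lemma sublinear_along p e : sublinear p -> sublinear (sublin_along p e).
Proof.
move=> sp; split=> [u v|c u].
  rewrite -lerBlDr; apply: sublin_along_ge => t t0.
  rewrite lerBlDr -lerBlDl; apply: sublin_along_ge => s s0.
  rewrite lerBlDl; apply: le_trans (sublin_along_le e _ sp (addr_ge0 t0 s0)) _.
  have := sublinD sp (u + t *: e) (v + s *: e).
  by rewrite addrACA -scalerDl; lra.
have leZ (d : R) w : 0 < d -> sublin_along p e (d *: w) <= d * sublin_along p e w.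
  move=> d0; rewrite -ler_pdivrMl//; apply: sublin_along_ge => t t0.
  rewrite ler_pdivrMl//.
  have dt0 : 0 <= d * t by rewrite mulr_ge0// ltW.
  apply: le_trans (sublin_along_le e _ sp dt0) _.
  by rewrite -scalerA -scalerDr (sublinZ sp) ?(ltW d0) // mulrBr mulrA.
rewrite le_eqVlt => /predU1P[<-|c0].
  rewrite scale0r mul0r; apply/eqP; rewrite eq_le; apply/andP; split.
    by have := sublin_along_leW e 0 sp; rewrite (sublin0 sp).
  by apply: sublin_along_ge => t t0; rewrite add0r (sublinZ sp)// subrr.
apply/eqP; rewrite eq_le leZ//=.
have := leZ c^-1 (c *: u); rewrite invr_gt0 => /(_ c0).
by rewrite scalerA mulVf ?gt_eqF// scale1r ler_pdivlMl.
Qed.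

Lemma sublin_along_lin p e : sublinear p ->
  sublin_along p e e + sublin_along p e (- e) <= 0.
Proof.
move=> sp; have := sublin_along_le e (- e) sp ler01.
rewrite scale1r addNr (sublin0 sp) mul1r.
by have := sublin_along_leW e e sp; lra.
Qed.

(** Later directions do not spoil the earlier ones, because each step only
    decreases the function. *)
Lemma sublinear_lin_on (es : seq E) p : sublinear p ->
  exists p', [/\ sublinear p', forall v, p' v <= p v &
    forall e, e \in es -> p' e + p' (- e) <= 0].
Proof.
elim: es p => [|e es IH] p sp; first by exists p; split.
have [p' [sp' p'le p'es]] := IH _ (sublinear_along e sp).
exists p'; split=> // [v|e'].
  exact: le_trans (p'le v) (sublin_along_leW e v sp).
rewrite inE => /predU1P[->|]; last exact: p'es.
by have := sublin_along_lin e sp; have := p'le e; have := p'le (- e); lra.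
Qed.

End Sublinear.

Section HahnBanach.
Context {R : realType} {n : nat}.

(** Hahn-Banach in finite dimension: after the reduction to a function p' that
    is additive along each basis vector, subadditivity applied to - v bounds
    p' v below by the linear function with the same values on the basis. *)
Lemma sublinear_minorant (p : 'cV[R]_n -> R) : sublinear p ->
  exists s : 'cV[R]_n, forall v, dotv s v <= p v.
Proof.
move=> sp.
have [p' [sp' p'le p'lin]] :=
  sublinear_lin_on [seq delta_mx i 0 | i <- enum 'I_n] sp.
exists (\col_i p' (delta_mx i 0)) => v; apply: le_trans (p'le v).
apply: le_trans (sublin_ge_opp v sp').
have sum_le (r : seq 'I_n) (F : 'I_n -> 'cV[R]_n) :
    p' (\sum_(i <- r) F i) <= \sum_(i <- r) p' (F i).
  elim: r => [|i r IH]; first by rewrite !big_nil (sublin0 sp').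
  by rewrite !big_cons; apply: le_trans (sublinD sp' _ _) _; rewrite lerD2l.
have -> : - v = \sum_i (- v i 0) *: delta_mx i 0.
  by rewrite [LHS]matrix_sum_delta; apply: eq_bigr => i _; rewrite big_ord1 mxE.
rewrite lerNr; apply: le_trans (sum_le _ _) _.
rewrite dotvE -sumrN; apply: ler_sum => i _; rewrite mxE.
have := p'lin (delta_mx i 0) (map_f _ (mem_enum _ i)).
have [vi|vi] := lerP 0 (- v i 0); first by rewrite (sublinZ sp')//; lra.
have -> : (- v i 0) *: delta_mx i 0 = v i 0 *: (- delta_mx i 0) :> 'cV[R]_n.
  by rewrite scalerN scaleNr.
by rewrite (sublinZ sp'); [nra|lra].
Qed.

Lemma convexE (f : 'cV[R]_n -> R) : convex_function (setT : set 'cV[R]_n) f ->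
  forall t x y, 0 <= t <= 1 ->
    f (t *: x + (1 - t) *: y) <= t * f x + (1 - t) * f y.
Proof.
move=> cf t x y /andP[t0 t1].
by have := cf (Itv01 t0 t1) x y; rewrite !inE => /(_ I I).
Qed.

End HahnBanach.

(** * Subgradients and Lagrange multipliers *)

Section DotCalculus.
Context {R : realType} {n : nat}.
Implicit Types u v w : 'cV[R]_n.

Lemma dotvDl u v w : dotv (u + v) w = dotv u w + dotv v w.
Proof. exact: linearDl. Qed.

Lemma dotvDr u v w : dotv u (v + w) = dotv u v + dotv u w.
Proof. exact: linearDr. Qed.

Lemma dotvNl u v : dotv (- u) v = - dotv u v.
Proof. exact: linearNl. Qed.

Lemma dotvNr u v : dotv u (- v) = - dotv u v.
Proof. exact: linearNr. Qed.

Lemma dotvZl c u v : dotv (c *: u) v = c * dotv u v.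
Proof. by rewrite /dotv linearZ -scalemxAl mxE. Qed.

Lemma dotvZr c u v : dotv u (c *: v) = c * dotv u v.
Proof. by rewrite dotvC dotvZl dotvC. Qed.

Lemma dotv0r u : dotv u 0 = 0.
Proof. exact: linear0r. Qed.

Lemma dotv0l u : dotv 0 u = 0.
Proof. exact: linear0l. Qed.

End DotCalculus.

Definition dotvs := (@dotvDl, @dotvDr, @dotvNl, @dotvNr, @dotvZl, @dotvZr).

Lemma dotv_mulmx (R : realType) m n (K : 'M[R]_(m, n)) u v :
  dotv (K *m u) v = dotv u (K^T *m v).
Proof. by rewrite /dotv trmx_mul mulmxA. Qed.

Section Multipliers.
Context {R : realType} {m n : nat}.
Variables (F : 'cV[R]_n -> R) (K : 'M[R]_(m, n)) (w0 : 'cV[R]_n).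
Hypothesis cF : convex_function (setT : set 'cV[R]_n) F.
Hypothesis w0_min : forall d, K *m d = 0 -> F w0 <= F (w0 + d).

(** The infimum of these quotients is a directional derivative of F at w0 that
    is allowed to move freely along the kernel of K: minimality of w0 keeps it
    finite, and a linear functional below it vanishes on the kernel. *)
Let quotients v : set R :=
  [set (F (w0 + t *: v + d) - F w0) / t |
    t in [set t : R | 0 < t] & d in [set d | K *m d = 0]].

Let slope v : R := inf (quotients v).

Let quotients_bound v y : quotients v y -> F w0 - F (w0 - v) <= y.
Proof.
case=> t /= t0 [d /= Kd <-]; rewrite ler_pdivlMr//.
have t1 : 0 < 1 + t by rewrite addr_gt0.
have /w0_min : K *m ((1 + t)^-1 *: d) = 0 by rewrite linearZ /= Kd scaler0.
have -> : w0 + (1 + t)^-1 *: d =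
    (1 + t)^-1 *: (w0 + t *: v + d) + (1 - (1 + t)^-1) *: (w0 - v).
  apply/matrixP => i j; rewrite !mxE; field; lra.
have /(convexE cF) : 0 <= (1 + t)^-1 <= 1.
  by rewrite invr_ge0 (ltW t1) invf_le1//; lra.
move=> /(_ (w0 + t *: v + d) (w0 - v)) H /le_trans/(_ H).
have -> : 1 - (1 + t)^-1 = t / (1 + t) by field; lra.
have -> (a b : R) : (1 + t)^-1 * a + t / (1 + t) * b = (a + t * b) / (1 + t).
  by field; lra.
by rewrite ler_pdivlMr//; lra.
Qed.

Let slope_le v t d : 0 < t -> K *m d = 0 ->
  slope v <= (F (w0 + t *: v + d) - F w0) / t.
Proof.
by move=> t0 Kd; apply: inf_le_elem (@quotients_bound v) _; exists t => //; exists d.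
Qed.

Let slope_ge v c :
  (forall t d, 0 < t -> K *m d = 0 -> c <= (F (w0 + t *: v + d) - F w0) / t) ->
  c <= slope v.
Proof.
move=> H; apply: lb_le_inf; last by move=> _ [t t0 [d Kd <-]]; apply: H.
exists ((F (w0 + 1 *: v + 0) - F w0) / 1); exists 1; first exact: ltr01.
by exists 0; rewrite //= mulmx0.
Qed.

Let sublinear_slope : sublinear slope.
Proof.
split=> [u v|c u].
  rewrite -lerBlDr; apply: slope_ge => t d t0 Kd.
  rewrite lerBlDr -lerBlDl; apply: slope_ge => s e s0 Ke.
  have ts : 0 < t + s by rewrite addr_gt0.
  have T0 : 0 < t * s / (t + s) by rewrite divr_gt0// mulr_gt0.
  have Kde : K *m ((s / (t + s)) *: d + (t / (t + s)) *: e) = 0.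
    by rewrite mulmxDr -!scalemxAr Kd Ke !scaler0 addr0.
  rewrite lerBlDl; apply: le_trans (slope_le (u + v) T0 Kde) _.
  have -> : w0 + (t * s / (t + s)) *: (u + v) +
      ((s / (t + s)) *: d + (t / (t + s)) *: e) =
      (s / (t + s)) *: (w0 + t *: u + d) +
      (1 - s / (t + s)) *: (w0 + s *: v + e).
    by apply/matrixP => i j; rewrite !mxE; field; lra.
  have /(convexE cF) : 0 <= s / (t + s) <= 1.
    by rewrite divr_ge0 ?(ltW s0) ?(ltW ts)//= ler_pdivrMr// mul1r; lra.
  move=> /(_ (w0 + t *: u + d) (w0 + s *: v + e)) H.
  rewrite ler_pdivrMr//.
  set a := F (w0 + t *: u + d) in H *; set b := F (w0 + s *: v + e) in H *.
  have -> : ((a - F w0) / t + (b - F w0) / s) * (t * s / (t + s)) =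
      s / (t + s) * a + (1 - s / (t + s)) * b - F w0 by field; lra.
  by rewrite lerD2r.
have leZ (c' : R) w : 0 < c' -> slope (c' *: w) <= c' * slope w.
  move=> c0; rewrite -ler_pdivrMl//; apply: slope_ge => t d t0 Kd.
  have tc0 : 0 < t / c' by rewrite divr_gt0.
  have := slope_le (c' *: w) tc0 Kd; rewrite scalerA divfK ?gt_eqF//.
  by rewrite invf_div mulrA ler_pdivrMl// mulrA [c' * _]mulrC.
rewrite le_eqVlt => /predU1P[<-|c0]; last first.
  apply/eqP; rewrite eq_le leZ//=.
  have := leZ c^-1 (c *: u); rewrite invr_gt0 => /(_ c0).
  by rewrite scalerA mulVf ?gt_eqF// scale1r ler_pdivlMl.
rewrite scale0r mul0r; apply/eqP; rewrite eq_le; apply/andP; split.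
  have := @slope_le 0 1 0 ltr01 (mulmx0 _ _).
  by rewrite scaler0 !addr0 subrr mul0r.
apply: slope_ge => t d t0 Kd; rewrite scaler0 addr0 divr_ge0 ?(ltW t0)//.
by rewrite subr_ge0 w0_min.
Qed.

(** A linear minorant of the slope vanishes on the kernel of K, hence lies in
    the row space of K; its coordinates on the rows of K are the multipliers. *)
Lemma multiplier_exists : exists g : 'cV[R]_m, subdiff F w0 (K^T *m g).
Proof.
have [s sle] := sublinear_minorant sublinear_slope.
have slope0 d : K *m d = 0 -> slope d <= 0.
  move=> Kd; have KNd : K *m (- d) = 0 by rewrite mulmxN Kd oppr0.
  by have := slope_le d ltr01 KNd; rewrite scale1r addrK subrr mul0r.
have s0 d : K *m d = 0 -> dotv s d = 0.
  move=> Kd; have KNd : K *m (- d) = 0 by rewrite mulmxN Kd oppr0.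
  have := sle d; have := sle (- d); have := slope0 _ Kd; have := slope0 _ KNd.
  by rewrite dotvNr; lra.
have /submxP[g sg] : (s^T <= K)%MS.
  rewrite submxE; apply/eqP/matrixP => i j; rewrite [i]ord1 mxE [RHS]mxE.
  have : K *m col j (cokermx K) = 0 by rewrite colE mulmxA mulmx_coker mul0mx.
  move=> /s0.
  rewrite dotvE => sj; rewrite -[RHS]sj; apply: eq_bigr => k _.
  by rewrite !mxE.
exists g^T => v; rewrite -[K^T *m _]trmxK trmx_mul !trmxK -sg trmxK.
have := le_trans (sle (v - w0)) (slope_le (v - w0) ltr01 (mulmx0 _ _)).
by rewrite scale1r addr0 subrKC divr1 lerBrDl.
Qed.

End Multipliers.

(** Any u minimizes f over the single point u, an affine constraint with matrix
    the identity. *)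
Lemma subdiff_neq0 (R : realType) n (f : 'cV[R]_n -> R) u :
  convex_function (setT : set 'cV[R]_n) f -> subdiff f u !=set0.
Proof.
move=> cf; have [|g fg] := @multiplier_exists _ n n f 1%:M u cf; last first.
  by exists (1%:M^T *m g).
by move=> d; rewrite mul1mx => ->; rewrite addr0.
Qed.

Section Subdifferential.
Context {R : realType} {n : nat}.
Implicit Types (f : 'cV[R]_n -> R) (H : 'M[R]_n).

Lemma subdiff_monotone f u v s t : subdiff f u s -> subdiff f v t ->
  0 <= dotv (u - v) (s - t).
Proof.
move=> /(_ v) H1 /(_ u) H2; move: H1 H2; rewrite !dotvs.
by rewrite (dotvC u s) (dotvC u t) (dotvC v s) (dotvC v t); lra.
Qed.

Lemma ge0_of_small (a c : R) :
  (forall t, 0 < t <= 1 -> 0 <= a + t * c) -> 0 <= a.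
Proof.
move=> H; apply/ler_addgt0Pl => e e0.
have cc : 0 <= `|c| by [].
pose t := Num.min 1 (e / (`|c| + 1)).
have t0 : 0 < t by rewrite lt_min ltr01 divr_gt0//; lra.
have te : t * (`|c| + 1) <= e.
  by rewrite -ler_pdivlMr; [rewrite ge_min lexx orbT|lra].
have := H t; rewrite t0 /= ge_min lexx /= => /(_ isT).
have := ler_norm c; nra.
Qed.

(** Monotonicity at points of the segment from u to v bounds the slopes of f
    along it below by that of s; a subgradient s0 at u supplies the
    semicontinuity needed to let the point tend to u. *)
Lemma subdiff_maximal f u s : convex_function (setT : set 'cV[R]_n) f ->
  (forall v t, subdiff f v t -> 0 <= dotv (v - u) (t - s)) -> subdiff f u s.
Proof.
move=> cf mon v; have [s0 us0] := subdiff_neq0 u cf.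
rewrite -subr_ge0; apply: (@ge0_of_small _ (dotv s (v - u) - dotv s0 (v - u))).
move=> t /andP[t0 t1].
have [st vst] := subdiff_neq0 (u + t *: (v - u)) cf.
have := mon _ _ vst; have := vst v; have := us0 (u + t *: (v - u)).
rewrite [_ + t *: _]addrC addrK.
have -> : v - (t *: (v - u) + u) = (1 - t) *: (v - u).
  by rewrite scalerBl scale1r opprD addrA addrAC.
rewrite !dotvZl !dotvZr pmulr_rge0// [dotv (v - u) _]dotvC.
rewrite [dotv (st - s) _]dotvDl dotvNl => H1 H2 H3; nra.
Qed.

(** Fermat's rule for the sum of a convex function and a quadratic q with
    gradient G at u: on a segment starting at u, the convex part is below its
    chord and the second-order part of q is negligible. *)
Lemma argmin_subdiff f (q : 'cV[R]_n -> R) G u s :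
  convex_function (setT : set 'cV[R]_n) f ->
  (forall t d, q (u + t *: d) = q u + t * dotv G d + t ^+ 2 * s d) ->
  argmin (fun v => f v + q v) u -> subdiff f u (- G).
Proof.
move=> cf qE umin v; rewrite -subr_ge0.
apply: (@ge0_of_small _ (s (v - u))) => t /andP[t0 t1].
have := umin (u + t *: (v - u)); rewrite qE.
have /(convexE cf) : 0 <= t <= 1 by rewrite t1 ltW.
move=> /(_ v u); have -> : t *: v + (1 - t) *: u = u + t *: (v - u).
  by apply/matrixP => i j; rewrite !mxE; ring.
rewrite dotvNl; nra.
Qed.

End Subdifferential.

(** * The KKT operator *)

Lemma dotZE (R : realType) n p m (z w : Zspace R n p m) :
  ipZ R n p m z w = dotv z.1.1 w.1.1 + dotv z.1.2 w.1.2 + dotv z.2 w.2.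
Proof. by []. Qed.

Section KKTOperator.
Context {R : realType} {n p m : nat}.
Variable P : problem R n p m.
Local Notation f := (obj_f P).
Local Notation g := (obj_g P).
Local Notation A := (mat_A P).
Local Notation B := (mat_B P).
Local Notation b := (rhs_b P).
Local Notation ip := (ipZ R n p m).

Lemma opT_intro x y gamma s t : subdiff f x s -> subdiff g y t ->
  opT P (x, y, gamma)
    (s - A^T *m gamma, t - B^T *m gamma, A *m x + B *m y - b).
Proof. by move=> xs yt; split=> //; split; [exists s|exists t]. Qed.

Lemma monotone_opT : Defs.monotone ip (opT P).
Proof.
move=> [[x y] c] [[x' y'] c'] [[a1 a2] a3] [[b1 b2] b3].
move=> [[[s xs /= <-] [t yt /= <-]] /= ->] [[[s' xs' /= <-] [t' yt' /= <-]] /= ->].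
have := addr_ge0 (subdiff_monotone xs xs') (subdiff_monotone yt yt').
rewrite dotZE /= !dotvs -!dotv_mulmx !(dotvC c) !(dotvC c'); lra.
Qed.

(** The monotonicity relation is affine in the multiplier, so letting the
    multiplier vary pins down the last component; the other two then decouple,
    by freezing one variable with an arbitrary subgradient. *)
Lemma maximal_monotone_opT :
  convex_function (setT : set 'cV[R]_n) f ->
  convex_function (setT : set 'cV[R]_p) g -> maximal_monotone ip (opT P).
Proof.
move=> cf cg; split=> [|T' mT' TT']; first exact: monotone_opT.
move=> [[x y] c] [[a1 a2] a3] T'a.
have rel x' y' c' s t : subdiff f x' s -> subdiff g y' t ->
    0 <= dotv (x' - x) (s - (a1 + A^T *m c)) +
         dotv (y' - y) (t - (a2 + B^T *m c)) +
         dotv (c' - c) (A *m x + B *m y - b - a3).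
  move=> xs yt; have := mT' _ _ _ _ (TT' _ _ (opT_intro c' xs yt)) T'a.
  rewrite dotZE /= !dotvs -!dotv_mulmx !(dotvC c) !(dotvC c'); lra.
have [s0 xs0] := subdiff_neq0 x cf; have [t0 yt0] := subdiff_neq0 y cg.
have a3E : a3 = A *m x + B *m y - b.
  apply/eqP; rewrite eq_sym -subr_eq0; apply: contraT => /dotv_gt0.
  set r := (X in dotv X X) => r0; have := rel x y (c - r) s0 t0 xs0 yt0.
  by rewrite !subrr !dotv0l !add0r addrAC subrr add0r dotvNl; lra.
have {}rel x' y' s t : subdiff f x' s -> subdiff g y' t ->
    0 <= dotv (x' - x) (s - (a1 + A^T *m c)) +
         dotv (y' - y) (t - (a2 + B^T *m c)).
  by move=> xs yt; have := rel _ _ c _ _ xs yt; rewrite a3E !subrr dotv0r addr0.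
have xa : subdiff f x (a1 + A^T *m c).
  apply: subdiff_maximal => // x' s xs; have := rel _ _ _ _ xs yt0.
  by rewrite subrr dotv0l addr0.
have ya : subdiff g y (a2 + B^T *m c).
  apply: subdiff_maximal => // y' t yt; have := rel _ _ _ _ xs0 yt.
  by rewrite subrr dotv0l add0r.
by have := opT_intro c xa ya; rewrite !addrK -a3E.
Qed.

Lemma convex_separable :
  convex_function (setT : set 'cV[R]_n) f ->
  convex_function (setT : set 'cV[R]_p) g ->
  convex_function (setT : set 'cV[R]_(n + p))
    (fun w => f (usubmx w) + g (dsubmx w)).
Proof.
move=> cf cg t u v _ _; have H := cf t (usubmx u) (usubmx v).
have K := cg t (dsubmx u) (dsubmx v); rewrite !inE in H K.
have := lerD (H I I) (K I I); congr (_ <= _).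
  by congr (f _ + g _); rewrite linearD !linearZ.
by rewrite !convRE; ring.
Qed.

Lemma zeros_opT_neq0 :
  convex_function (setT : set 'cV[R]_n) f ->
  convex_function (setT : set 'cV[R]_p) g ->
  solutions P !=set0 -> zeros (opT P) !=set0.
Proof.
move=> cf cg [[x y] [/= xyb xymin]].
pose F (w : 'cV[R]_(n + p)) := f (usubmx w) + g (dsubmx w).
have [|c Fc] := @multiplier_exists _ m _ F (row_mx A B) (col_mx x y)
  (convex_separable cf cg).
  move=> d; rewrite -[d]vsubmxK mul_row_col => Kd.
  rewrite /F add_col_mx !col_mxKu !col_mxKd; apply: xymin.
  by rewrite !mulmxDr addrACA xyb Kd addr0.
move: Fc; rewrite tr_row_mx mul_col_mx => Fc.
exists (x, y, c).
have FcE x' y' : f x + g y + (dotv (A^T *m c) (x' - x) + dotv (B^T *m c) (y' - y))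
    <= f x' + g y'.
  have := Fc (col_mx x' y'); rewrite /F opp_col_mx add_col_mx !col_mxKu !col_mxKd.
  by rewrite [dotv _ _ in X in X -> _]/dotv tr_col_mx mul_row_col mxE.
have xc : subdiff f x (A^T *m c).
  by move=> x'; have := FcE x' y; rewrite subrr dotv0r; lra.
have yc : subdiff g y (B^T *m c).
  by move=> y'; have := FcE x y'; rewrite subrr dotv0r; lra.
by have := opT_intro c xc yc; rewrite !subrr xyb subrr.
Qed.

End KKTOperator.

(** * One iteration of the ADMM *)

Section Seminorms.
Context {R : realType} {n : nat}.
Implicit Types (u v d : 'cV[R]_n) (H : 'M[R]_n).

Lemma norm2_sqr u : norm2 u ^+ 2 = dotv u u.
Proof. by rewrite sqr_sqrtr// dotv_ge0. Qed.

Lemma mxnorm_sqr H u : mxpsd H -> mxnorm H u ^+ 2 = dotv (H *m u) u.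
Proof. by case=> _ H0; rewrite sqr_sqrtr; [|exact: H0]. Qed.

Lemma mxpsdC H u v : mxpsd H -> dotv (H *m u) v = dotv (H *m v) u.
Proof. by case=> HT _; rewrite dotv_mulmx HT dotvC. Qed.

Lemma dotv_line u d t :
  dotv (u + t *: d) (u + t *: d) =
    dotv u u + t * (2 * dotv u d) + t ^+ 2 * dotv d d.
Proof. by rewrite !dotvs (dotvC d u); ring. Qed.

Lemma mxnorm_line H u d t : mxpsd H ->
  dotv (H *m (u + t *: d)) (u + t *: d) =
    dotv (H *m u) u + t * (2 * dotv (H *m u) d) + t ^+ 2 * dotv (H *m d) d.
Proof.
by move=> psdH; rewrite mulmxDr -scalemxAr !dotvs (mxpsdC d u psdH); ring.
Qed.

End Seminorms.

(** The vector w of the introduction. *)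
Definition dual_gap (R : realType) n p m (D : parameters R n p m)
    (c : admm_config R n p m) (i : admm_iterate R n p m) : 'cV[R]_m :=
  (par_beta D * par_theta D)^-1 *: admm_dgamma c i.

Section ADMMStep.
Context {R : realType} {n p m : nat}.
Variables (P : problem R n p m) (D : parameters R n p m).
Hypothesis hyp : standing_assumptions P D.

Local Notation f := (obj_f P).
Local Notation g := (obj_g P).
Local Notation A := (mat_A P).
Local Notation B := (mat_B P).
Local Notation b := (rhs_b P).
Local Notation beta := (par_beta D).
Local Notation theta := (par_theta D).
Local Notation alpha := (par_alpha D).
Local Notation MR := (par_R D).
Local Notation MS := (par_S D).
Local Notation Q := (opQ P D).
Local Notation ip := (ipZ R n p m).

Lemma opQ_form z w : ip (Q z) w =
  dotv (MR *m z.1.1) w.1.1 + (1 + alpha) * beta * dotv (B *m z.1.2) (B *m w.1.2)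
  + dotv (MS *m z.1.2) w.1.2 + (beta * theta)^-1 * dotv z.2 w.2.
Proof.
rewrite dotZE /= mulmxDl -scalemxAl -mulmxA !dotvs (dotv_mulmx B^T) trmxK.
by rewrite [theta * _]mulrC addrA.
Qed.

Lemma selfadjoint_psd_opQ : selfadjoint_psd ip Q.
Proof.
have [_ _ _ be0 th0 _ al0 Rpsd Spsd _] := hyp.
split=> [a z w|z w|z].
- rewrite /opQ /= !mulmxDr -!scalemxAr.
  by congr (_, _, _); rewrite /= scalerDr !scalerA [a * _]mulrC.
- by rewrite [RHS]dotZC -!/(ip _ _) !opQ_form (mxpsdC _ _ Rpsd) (mxpsdC _ _ Spsd)
    (dotvC (B *m _)) (dotvC z.2).
- rewrite opQ_form; apply: addr_ge0; [apply: addr_ge0; [apply: addr_ge0|]|].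
  + exact: Rpsd.2.
  + by rewrite !mulr_ge0 ?dotv_ge0 ?addr_ge0 ?(ltW be0).
  + exact: Spsd.2.
  + by rewrite mulr_ge0 ?dotv_ge0 ?invr_ge0 ?mulr_ge0 ?(ltW be0) ?(ltW th0).
Qed.

Lemma seminorm_opQ u v w : seminorm ip Q (u, v, w) = admm_residual P D u v w.
Proof.
have [_ _ _ _ _ _ _ Rpsd Spsd _] := hyp.
by rewrite /seminorm /admm_residual opQ_form /= !mxnorm_sqr// norm2_sqr norm2_sqr.
Qed.

Variables (c : admm_config R n p m) (i : admm_iterate R n p m).
Hypothesis mu_gt0 : 0 < admm_mu c.
Hypothesis stepci : admm_step P D c i.
Local Notation mu := (admm_mu c).
Local Notation x := (admm_x i).
Local Notation y := (admm_y i).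
Local Notation gt := (admm_gammat i).

Let be0 : 0 < beta. Proof. by case: hyp. Qed.
Let th0 : 0 < theta. Proof. by case: hyp. Qed.
Let be_neq0 : beta != 0. Proof. by rewrite gt_eqF. Qed.
Let th_neq0 : theta != 0. Proof. by rewrite gt_eqF. Qed.
Let mu1_neq0 : 1 + mu != 0. Proof. by rewrite gt_eqF// addr_gt0. Qed.
Let thmu_neq0 : theta + mu != 0. Proof. by rewrite gt_eqF// addr_gt0. Qed.

(** Optimality of x_k, with the terms regrouped so that mu enters only through
    the vector v^x_k. *)
Lemma admm_x_subdiff :
  subdiff f x (A^T *m gt + MR *m (admm_vx D c i)).
Proof.
have [cf _ _ _ _ _ _ Rpsd _ _] := hyp; have [xmin gtE _ _] := stepci.
set gh := _^-1 *: _ in xmin gtE; set b1 := beta * theta / (theta + mu) in xmin gtE.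
set xh := (1 + mu)^-1 *: _ in xmin.
set r := A *m x + B *m admm_yprev c - b in gtE.
pose q v := - dotv gh (A *m v)
  + b1 / 2 * norm2 (A *m v + B *m admm_yprev c - b) ^+ 2
  + (1 + mu) / 2 * mxnorm MR (v - xh) ^+ 2.
have qmin : argmin (fun v => f v + q v) x.
  by move=> v; have := xmin v; rewrite /q /= !addrA.
pose G := - (A^T *m gt) + (1 + mu) *: (MR *m (x - xh)).
pose s d := b1 / 2 * dotv (A *m d) (A *m d) + (1 + mu) / 2 * dotv (MR *m d) d.
have qE t d : q (x + t *: d) = q x + t * dotv G d + t ^+ 2 * s d.
  rewrite /q !mxnorm_sqr// !norm2_sqr.
  have -> : A *m (x + t *: d) + B *m admm_yprev c - b = r + t *: (A *m d).
    by rewrite mulmxDr -scalemxAr addrAC -addrA addrAC addrA (addrAC _ (- b)).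
  have -> : x + t *: d - xh = x - xh + t *: d by rewrite addrAC.
  rewrite dotv_line mxnorm_line// /G /s [dotv (_ + _ *: (MR *m _)) d]dotvDl.
  rewrite [dotv (- _) d]dotvNl dotvZl.
  rewrite [A *m (x + _)]mulmxDr -[A *m (t *: d)]scalemxAr.
  (* [dotvs] would expand the local definitions *)
  rewrite (dotv_mulmx A^T) trmxK gtE -/r; clearbody r gh b1 xh.
  by rewrite !dotvs; field.
have := argmin_subdiff cf qE qmin; congr (subdiff _ _ _).
rewrite /G opprD opprK; congr (_ + _).
rewrite -scalerN -mulmxN scalemxAr; congr (_ *m _).
rewrite /admm_vx /admm_dx /xh; apply/matrixP => j k; rewrite !mxE.
by field; rewrite ?mu1_neq0.
Qed.

Local Notation MQ := (((1 + alpha) * beta) *: (B^T *m B) + MS).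

Lemma admm_y_subdiff :
  subdiff g y (B^T *m gt + MQ *m (admm_vy D c i)).
Proof.
have [_ cg _ _ _ _ _ _ Spsd _] := hyp; have [_ _ ymin _] := stepci.
set b2 := beta * (1 + mu) in ymin.
set yh := (1 + mu)^-1 *: _ in ymin.
set u := gt + _ in ymin.
pose q v := - dotv u (B *m v) + b2 / 2 * (norm2 (A *m x + B *m v - b) ^+ 2
                       + alpha * norm2 (B *m (v - yh)) ^+ 2
                       + beta^-1 * mxnorm MS (v - yh) ^+ 2).
have qmin : argmin (fun v => g v + q v) y.
  by move=> v; have := ymin v; rewrite /q /= !addrA.
pose G := - (B^T *m gt) + (1 + mu) *: (MQ *m (y - yh)).
pose s d := b2 / 2 * ((1 + alpha) * dotv (B *m d) (B *m d)
   + beta^-1 * dotv (MS *m d) d).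
have qE t d : q (y + t *: d) = q y + t * dotv G d + t ^+ 2 * s d.
  rewrite /q !mxnorm_sqr// !norm2_sqr.
  have -> : A *m x + B *m (y + t *: d) - b =
      (A *m x + B *m y - b) + t *: (B *m d).
    by rewrite mulmxDr -scalemxAr addrA [LHS]addrAC.
  have -> : y + t *: d - yh = y - yh + t *: d by rewrite addrAC.
  rewrite [B *m (y - yh + _)]mulmxDr -[B *m (t *: d)]scalemxAr.
  rewrite !dotv_line mxnorm_line// /G /s.
  have -> : A *m x + B *m y - b = (A *m x + B *m yh - b) + B *m (y - yh).
    have vec (u1 u2 u3 u4 : 'cV[R]_m) : u1 + u2 - u4 = (u1 + u3 - u4) + (u2 - u3).
      by apply/matrixP => j k; rewrite !mxE; ring.
    by rewrite mulmxBr -vec.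
  set r := A *m x + B *m yh - b; rewrite /u -/r.
  rewrite [B *m (y + _)]mulmxDr -[B *m (t *: d)]scalemxAr.
  rewrite mulmxDl -scalemxAl -mulmxA.
  rewrite [dotv (- _ + _) d]dotvDl dotvNl dotvZl [dotv (_ + MS *m _) d]dotvDl.
  rewrite dotvZl !(dotv_mulmx B^T) trmxK /b2; clearbody r yh.
  by rewrite !dotvs; field; rewrite be_neq0.
have := argmin_subdiff cg qE qmin; congr (subdiff _ _ _).
rewrite /G opprD opprK; congr (_ + _).
rewrite -scalerN -mulmxN scalemxAr; congr (_ *m _).
rewrite /admm_vy /admm_dy /yh; apply/matrixP => j k; rewrite !mxE.
by field; rewrite ?mu1_neq0.
Qed.

Lemma admm_gammat_prev : admm_gammaprev c - gt =
  beta *: (dual_gap D c i + B *m admm_dy c i).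
Proof.
have [_ gtE _ gE] := stepci.
rewrite /dual_gap /admm_dgamma gE /admm_dy mulmxBr; move: gtE.
move: (A *m x) (B *m admm_yprev c) (B *m y) => Ax Byp By /matrixP gtE.
apply/matrixP => j k; have := gtE j k.
by rewrite !mxE => ->; field; rewrite be_neq0 th_neq0 thmu_neq0.
Qed.

Lemma admm_gamma_gammat : admm_gamma i - gt =
  beta *: ((1 - theta) *: dual_gap D c i + B *m admm_dy c i).
Proof.
have := admm_gammat_prev; set a := B *m _.
have -> : admm_gamma i = admm_gammaprev c - (beta * theta) *: dual_gap D c i.
  rewrite /dual_gap scalerA divff ?mulf_neq0 ?gt_eqF// scale1r /admm_dgamma.
  by rewrite opprB subrKC.
rewrite addrAC => ->; apply/matrixP => j k; rewrite !mxE; ring.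
Qed.

Lemma admm_opT : opT P (x, y, gt)
  (Q (admm_vx D c i, admm_vy D c i, admm_vgamma D c i)).
Proof.
have := opT_intro gt admm_x_subdiff admm_y_subdiff.
rewrite ![_ + _ - (_ *m gt)]addrAC !subrr !add0r.
congr (opT P _ (_, _, _)).
have [_ _ _ gE] := stepci; rewrite /admm_vgamma /admm_dgamma gE.
move: (A *m x + B *m y - b) => r; apply/matrixP => j k; rewrite !mxE.
by field; rewrite be_neq0 th_neq0.
Qed.

Lemma admm_inclusion :
  regularize (opT P) mu Q (startZ D) (x, y, gt)
    (Q (admm_dx c i, admm_dy c i, admm_dgamma c i)).
Proof.
eexists; first exact: admm_opT.
have [linQ _ _] := selfadjoint_psd_opQ.
rewrite addrC -linQ; congr (Q (_, _, _)) => /=; exact: subrKC.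
Qed.

End ADMMStep.

(** * The descent inequality of the framework *)

Section HPEStep.
Context {R : realType} {V : vectType R}.
Variables (ip : {dot V for (@idfun R)}) (T : V -> set V) (M : V -> V) (z0 : V).
Hypothesis Mpsd : selfadjoint_psd ip M.
Hypothesis monT : Defs.monotone ip T.

Let q u v := ip (M u) v.

Let qC u v : q u v = q v u.
Proof. by have [_ Msym _] := Mpsd; rewrite /q Msym hermC expr0 mul1r. Qed.

Let ipDr u v w : ip u (v + w) = ip u v + ip u w.
Proof. exact: linearDr. Qed.

Let ipNr u v : ip u (- v) = - ip u v.
Proof. exact: linearNr. Qed.

Let ipZr c u v : ip u (c *: v) = c * ip u v.
Proof. exact: linearZr_LR. Qed.

Let qip u v : ip u (M v) = q v u.
Proof. by rewrite hermC expr0 mul1r. Qed.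

Let qDr u v w : q u (v + w) = q u v + q u w.
Proof. exact: ipDr. Qed.

Let qNr u v : q u (- v) = - q u v.
Proof. exact: ipNr. Qed.

Let qDl u v w : q (u + v) w = q u w + q v w.
Proof. by rewrite qC qDr !(qC w). Qed.

Let qNl u v : q (- u) v = - q u v.
Proof. by rewrite qC qNr qC. Qed.

Let qZr c u v : q u (c *: v) = c * q u v.
Proof. exact: ipZr. Qed.

Let qZl c u v : q (c *: u) v = c * q u v.
Proof. by rewrite qC qZr qC. Qed.

Let qs := (qDl, qDr, qNl, qNr, qZl, qZr).

Lemma seminorm_sqr u : seminorm ip M u ^+ 2 = ip (M u) u.
Proof. by have [_ _ M0] := Mpsd; rewrite sqr_sqrtr; [|exact: M0]. Qed.

Lemma seminorm_le u r : 0 <= r -> (seminorm ip M u <= r) = (ip (M u) u <= r ^+ 2).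
Proof.
have [_ _ M0] := Mpsd.
by move=> r0; rewrite -seminorm_sqr ler_pXn2r// nnegrE ?sqrtr_ge0.
Qed.

Let q_ge0 u : 0 <= q u u.
Proof. by have [_ _ M0] := Mpsd; apply: M0. Qed.

Lemma form_sum_le u v : ip (M (u + v)) (u + v) <= 2 * ip (M u) u + 2 * ip (M v) v.
Proof.
have := q_ge0 (u - v); rewrite -![ip (M _) _]/(q _ _) !qs (qC v u); lra.
Qed.

Lemma form_chain_le a b c :
  ip (M (a - c)) (a - c) <= 2 * ip (M (a - b)) (a - b) + 2 * ip (M (b - c)) (b - c).
Proof. by have := form_sum_le (a - b) (b - c); rewrite subrKA. Qed.

Lemma formNZ a u : ip (M (- (a *: u))) (- (a *: u)) = a ^+ 2 * ip (M u) u.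
Proof. by rewrite -![ip (M _) _]/(q _ _) !qs; ring. Qed.

Lemma form_sym a b : ip (M (a - b)) (a - b) = ip (M (b - a)) (b - a).
Proof. by rewrite -![ip (M _) _]/(q _ _) !qs; ring. Qed.

(** Monotonicity between zs and z puts z0 - zs and zs - z at an acute angle for
    the form of M. *)
Lemma regularized_zero_le mu zs z : 0 < mu -> zeros (regularize T mu M z0) zs ->
  zeros T z -> ip (M (z0 - zs)) (z0 - zs) <= ip (M (z0 - z)) (z0 - z).
Proof.
move=> mu0 [w Tw wE] Tz; have := monT Tw Tz.
have {wE} -> : w = - (mu *: M (zs - z0)) by apply/eqP; rewrite -addr_eq0 wE.
rewrite subr0 ipNr ipZr qip oppr_ge0 pmulr_rle0// => H.
have := q_ge0 (zs - z); move: H.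
rewrite -![ip (M _) _]/(q _ _) !qs (qC zs z0) (qC z z0) (qC z zs); lra.
Qed.

Definition dist_zeros := inf [set seminorm ip M (z0 - z) | z in zeros T].

Lemma dist_zeros_ge0 : zeros T !=set0 -> 0 <= dist_zeros.
Proof.
move=> [z Tz]; apply: lb_le_inf; first by exists (seminorm ip M (z0 - z)), z.
by move=> _ [u _ <-]; apply: sqrtr_ge0.
Qed.

Lemma regularized_zero_dist mu zs : 0 < mu -> zeros (regularize T mu M z0) zs ->
  zeros T !=set0 -> ip (M (z0 - zs)) (z0 - zs) <= dist_zeros ^+ 2.
Proof.
move=> mu0 zsP T0; rewrite -seminorm_le ?dist_zeros_ge0//.
have [z Tz] := T0.
apply: lb_le_inf; first by exists (seminorm ip M (z0 - z)), z.
move=> _ [u Tu <-]; rewrite seminorm_le ?sqrtr_ge0// seminorm_sqr.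
exact: regularized_zero_le zsP Tu.
Qed.

(** Three-point identity for zp, z and zs, plus monotonicity between zt and
    zs. *)
Lemma hpe_descent mu zs zp z zt : zeros (regularize T mu M z0) zs ->
  regularize T mu M z0 zt (M (zp - z)) ->
  ip (M (zs - z)) (zs - z) + ip (M (zp - zt)) (zp - zt)
    + 2 * mu * ip (M (zt - zs)) (zt - zs)
  <= ip (M (zs - zp)) (zs - zp) + ip (M (z - zt)) (z - zt).
Proof.
move=> [ws Tws wsE] [w Tw wE]; have := monT Tw Tws.
have -> : w = M (zp - z) - mu *: M (zt - z0) by rewrite -wE addrK.
have {wsE} -> : ws = - (mu *: M (zs - z0)) by apply/eqP; rewrite -addr_eq0 wsE.
rewrite opprK !ipDr !ipNr !ipZr !qip.
rewrite -![ip (M _) _]/(q _ _) !qs.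
rewrite (qC zs zp) (qC zs z) (qC zt z) (qC zt zp) (qC zt zs) (qC z0 zs) (qC z0 zt).
lra.
Qed.

End HPEStep.

(** * Iteration count of the framework *)

Section HPEComplexity.
Context {R : realType} {V : vectType R}.
Variables (ip : {dot V for (@idfun R)}) (T : V -> set V) (M : V -> V) (z0 : V).
Variables (eta0 sigma tau rho kappa : R).
Hypothesis adm : hpe_admissible ip T M eta0 sigma tau rho.
Hypothesis reg : forall mu, 0 < mu -> zeros (regularize T mu M z0) !=set0.
Hypothesis kappa_ge0 : 0 <= kappa.
Local Notation d := (dist_zeros ip T M z0).
Hypothesis eta0_le : eta0 <= kappa * d ^+ 2.

Let sigma0 : 0 <= sigma. Proof. by case: adm => _ _ _ /andP[]. Qed.
Let sigma1 : sigma < 1. Proof. by case: adm => _ _ _ /andP[]. Qed.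
Let tau0 : 0 < tau. Proof. by case: adm => _ _ _ _ /andP[]. Qed.
Let tau1 : tau < 1. Proof. by case: adm => _ _ _ _ /andP[]. Qed.
Let rho0 : 0 < rho. Proof. by case: adm. Qed.
Let params : [/\ 0 <= sigma, sigma < 1, 0 < tau, tau < 1 & 0 < rho].
Proof. by []. Qed.
Let Mpsd : selfadjoint_psd ip M. Proof. by case: adm. Qed.
Let monT : Defs.monotone ip T. Proof. by case: adm => -[]. Qed.
Let T0 : zeros T !=set0. Proof. by case: adm. Qed.
Let d0 : 0 <= d. Proof. exact: dist_zeros_ge0. Qed.
Let M0 u : 0 <= ip (M u) u. Proof. by case: Mpsd. Qed.

(** rate * mu is the fraction of the energy lost at each iteration; drift * d
    bounds the distance from z0 to the points zt of a run. *)
Definition rate : R := Num.min ((1 - sigma) / 2) tau.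
Definition drift : R := 1 + 4 * ((1 + kappa) / (1 - sigma) + 2 + kappa).

Lemma rate_gt0 : 0 < rate.
Proof. by rewrite lt_min tau0 divr_gt0 ?subr_gt0. Qed.

Lemma rate_le : rate <= (1 - sigma) / 2 /\ rate <= tau.
Proof. by rewrite /rate ge_min lexx ge_min lexx orbT. Qed.

Lemma drift_sqr : 4 * ((1 + kappa) / (1 - sigma) + 2 + kappa) <= drift ^+ 2.
Proof.
have : 0 <= (1 + kappa) / (1 - sigma).
  by apply: divr_ge0; [exact: addr_ge0|rewrite subr_ge0 ltW].
by rewrite /drift; move: kappa_ge0; nra.
Qed.

Lemma drift_ge0 : 0 <= drift.
Proof.
have : 0 <= (1 + kappa) / (1 - sigma).
  by apply: divr_ge0; [exact: addr_ge0|rewrite subr_ge0 ltW].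
by rewrite /drift; move: kappa_ge0; lra.
Qed.

Definition energy_bound : R := (1 + kappa) * d ^+ 2.

(** The energy level below which the first test succeeds is rho^2 / 16; the
    factor expR 1 makes excess at least 1 above that level, so that it can
    decrease by rate * mu <= 1 without being truncated at 0. *)
Definition excess e : R := Num.max (ln (expR 1 * (16 * e / rho ^+ 2))) 0.
Definition cycle_cost : R := 1 + excess energy_bound / rate.
Definition mu_range : R := 2 + 8 * drift * d / rho.

(** A bound on the number of iterations left: the first term for the current
    cycle, the second one for the cycles to come, a cycle with parameter mu'
    being charged cycle_cost / mu'.  The sum of these charges over the halvings
    of mu telescopes, since 1 / (mu / 2) = 2 / (mu / 2) - 2 / mu. *)
Definition potential mu e : R :=
  excess e / (rate * mu) + cycle_cost * (mu_range - 2 / mu).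

Definition energy_invariant (c : hpe_config R V) (e : R) : Prop :=
  [/\ 0 < hpe_mu c <= 1, 2 / hpe_mu c <= mu_range, 0 <= e <= energy_bound,
      0 <= hpe_etaprev c &
      exists2 zs, zeros (regularize T (hpe_mu c) M z0) zs &
        ip (M (zs - hpe_zprev c)) (zs - hpe_zprev c) + hpe_etaprev c <= e].

Lemma excess_ge0 e : 0 <= excess e.
Proof. by rewrite /excess le_max lexx orbT. Qed.

Lemma energy_bound_ge0 : 0 <= energy_bound.
Proof. by rewrite /energy_bound mulr_ge0 ?sqr_ge0 ?addr_ge0. Qed.

Lemma cycle_cost_ge1 : 1 <= cycle_cost.
Proof. by rewrite lerDl divr_ge0 ?excess_ge0 ?(ltW rate_gt0). Qed.

Lemma potential_ge0 c e : energy_invariant c e -> 0 <= potential (hpe_mu c) e.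
Proof.
case=> /andP[mu0 _] muG _ _ _; rewrite addr_ge0//.
  by rewrite divr_ge0 ?excess_ge0// mulr_ge0 ?(ltW mu0) ?(ltW rate_gt0).
by rewrite mulr_ge0 ?subr_ge0// (le_trans ler01 cycle_cost_ge1).
Qed.

Lemma restart_invariant mu : 0 < mu <= 1 -> 2 / mu <= mu_range ->
  energy_invariant (HpeConfig mu z0 eta0) energy_bound.
Proof.
move=> /[dup] mu01 /andP[mu0 _] muG; split=> //=.
- by rewrite energy_bound_ge0 lexx.
- by case: adm.
have [zs zsP] := reg mu0; exists zs => //.
have := regularized_zero_dist Mpsd monT mu0 zsP T0.
rewrite (form_sym Mpsd) /energy_bound mulrDl mul1r => H.
exact: lerD H eta0_le.
Qed.

(** The decrease in hpe_descent controls zp - zt and zt - zs, hence zp - zs: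
    this turns it into a contraction of the energy. *)
Lemma energy_step c i e : energy_invariant c e ->
  hpe_step ip T M z0 sigma tau c i ->
  exists zs, [/\ zeros (regularize T (hpe_mu c) M z0) zs,
    ip (M (zs - hpe_zprev c)) (zs - hpe_zprev c) <= e,
    (1 - sigma) * ip (M (hpe_zprev c - hpe_zt i)) (hpe_zprev c - hpe_zt i) <= e &
    ip (M (zs - hpe_z i)) (zs - hpe_z i) + hpe_eta i <=
      (1 - rate * hpe_mu c) * e].
Proof.
case=> /andP[mu0 mu1] _ _ eta_ge0 [zs zsP zse] [incl etai ineq].
exists zs; have := hpe_descent Mpsd monT zsP incl.
have := M0 (zs - hpe_z i); have := M0 (hpe_zprev c - hpe_zt i).
have := M0 (hpe_zt i - zs).
have := form_chain_le Mpsd zs (hpe_zt i) (hpe_zprev c).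
have [s0 s1 t0 t1 _] := params.
move: ineq; rewrite !seminorm_sqr//.
rewrite (form_sym Mpsd zs (hpe_zt i)) (form_sym Mpsd (hpe_zt i) (hpe_zprev c)).
move: zse etai eta_ge0 mu0 mu1.
set mu := hpe_mu c; set a := ip (M (zs - hpe_zprev c)) _.
set b := ip (M (zs - hpe_z i)) _; set p := ip (M (hpe_zprev c - hpe_zt i)) _.
set r := ip (M (hpe_zt i - zs)) _; set t := ip (M (hpe_z i - hpe_zt i)) _.
set ei := hpe_eta i; set ep := hpe_etaprev c.
move=> ae ei0 ep0 mu0 mu1 ineq apr r0 p0 b0 desc.
have a0 : 0 <= a by exact: M0.
have tau_ep : 0 <= tau * ep by rewrite mulr_ge0//; lra.
have mur : 0 <= mu * r by rewrite mulr_ge0// ltW.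
have sp : 0 <= (1 - sigma) * p by rewrite mulr_ge0//; lra.
split=> //; [lra|lra|].
have [r1 r2] := rate_le; have r3 := rate_gt0.
have rmu : rate * mu <= (1 - sigma) / 2 * mu by rewrite ler_wpM2r// ltW.
have rmut : rate * mu <= tau by apply: le_trans r2; rewrite ler_piMr// ltW.
have k1 : rate * mu * a <= (1 - sigma) / 2 * mu * a by rewrite ler_wpM2r.
have k2 : rate * mu * ep <= tau * ep by rewrite ler_wpM2r.
have k3 : mu * a <= mu * (2 * r + 2 * p) by rewrite ler_wpM2l ?(ltW mu0)//; lra.
have k4 : (1 - sigma) * (mu * a) <= (1 - sigma) * (mu * (2 * r + 2 * p)).
  by rewrite ler_wpM2l//; lra.
have k5 : (1 - sigma) * (mu * p) <= (1 - sigma) * p.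
  by rewrite ler_wpM2l; [|lra|rewrite ler_piMl].
have k6 : (1 - sigma) * (mu * r) <= mu * r by rewrite ler_piMl//; lra.
have k7 : (1 - rate * mu) * (a + ep) <= (1 - rate * mu) * e.
  by rewrite ler_wpM2l//; lra.
lra.
Qed.

Lemma potential_inner_step mu e : 0 < mu <= 1 -> rho ^+ 2 / 16 < e ->
  potential mu ((1 - rate * mu) * e) + 1 <= potential mu e.
Proof.
move=> /andP[mu0 mu1] e_big; have [r1 r2] := rate_le; have r3 := rate_gt0.
have [s0 s1 t0 t1 rh0] := params.
have rmu0 : 0 < rate * mu by rewrite mulr_gt0.
have rmu1 : rate * mu < 1.
  by rewrite (@le_lt_trans _ _ rate) ?ler_piMr ?(ltW r3)//; lra.
have rho2 : 0 < rho ^+ 2 by rewrite exprn_gt0.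
have x1 : 1 < 16 * e / rho ^+ 2 by rewrite ltr_pdivlMr//; lra.
have x0 : 0 < 16 * e / rho ^+ 2 by lra.
have lnE (x : R) : 0 < x -> ln (expR 1 * x) = 1 + ln x.
  by move=> x_gt0; rewrite lnM ?posrE ?expR_gt0// expRK.
have lnx : 0 < ln (16 * e / rho ^+ 2) by rewrite ln_gt0.
have exE : excess e = 1 + ln (16 * e / rho ^+ 2).
  by rewrite /excess lnE// max_l//; lra.
have exE' : excess ((1 - rate * mu) * e) <= excess e - rate * mu.
  rewrite {1}/excess ge_max exE; apply/andP; split; last by lra.
  have -> : 16 * ((1 - rate * mu) * e) / rho ^+ 2 =
      (1 - rate * mu) * (16 * e / rho ^+ 2) by ring.
  have u0 : 0 < 1 - rate * mu by lra.
  rewrite lnE ?(mulr_gt0 u0 x0)// lnM ?posrE//.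
  have := @le_ln1Dx R (- (rate * mu)); rewrite ltrN2 => /(_ rmu1).
  lra.
have : 0 < (rate * mu)^-1 by rewrite invr_gt0.
move=> /ltW /ler_wpM2r /(_ _ _ exE'); rewrite [leRHS]mulrBl divff ?gt_eqF//.
by rewrite /potential; lra.
Qed.

Lemma potential_restart mu e : 0 < mu <= 1 ->
  potential (mu / 2) energy_bound + 1 <= potential mu e.
Proof.
move=> /andP[mu0 mu1]; have r3 := rate_gt0.
rewrite /potential /cycle_cost; set L := excess energy_bound.
have -> : L / (rate * (mu / 2)) + (1 + L / rate) * (mu_range - 2 / (mu / 2)) + 1
  = (1 + L / rate) * (mu_range - 2 / mu) - (2 / mu - 1).
  by field; rewrite !gt_eqF.
have : 0 <= excess e / (rate * mu).
  by rewrite divr_ge0 ?excess_ge0// ltW// mulr_gt0.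
have : 1 <= 2 / mu by rewrite ler_pdivlMr//; lra.
lra.
Qed.

(** If the first test fails, the energy is still above rho^2 / 16.  If it
    succeeds and the second one fails, the drift term mu (zt - z0) has norm more
    than rho / 2, so that mu is not yet too small. *)
Lemma potential_step c i e : energy_invariant c e ->
  hpe_step ip T M z0 sigma tau c i ->
  ~~ (hpe_test2 ip M rho c i && hpe_test3 ip M z0 rho c i) ->
  exists2 e', energy_invariant (hpe_next ip M z0 eta0 rho c i) e' &
    potential (hpe_mu (hpe_next ip M z0 eta0 rho c i)) e' + 1
    <= potential (hpe_mu c) e.
Proof.
move=> inv step; have [zs [zsP dp pp de]] := energy_step inv step.
case: inv => /[dup] mu01 /andP[mu0 mu1] muG /andP[e0 eE] ep0 _.
have [r1 r2] := rate_le; have r3 := rate_gt0.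
have [s0 s1 t0 t1 rh0] := params.
have rmu0 : 0 < rate * hpe_mu c by rewrite mulr_gt0.
have rmu1 : rate * hpe_mu c < 1.
  by rewrite (@le_lt_trans _ _ rate) ?ler_piMr ?(ltW r3)//; lra.
have [_ ei0 _] := step; have rho20 : 0 <= rho / 2 by rewrite divr_ge0// ltW.
rewrite /hpe_next; case: ifPn => [test2|ntest2].
  rewrite /= /hpe_test3 seminorm_le// ?(ltW rho0)// -ltNge => test3.
  exists energy_bound; last exact: potential_restart.
  apply: restart_invariant; first by apply/andP; split; lra.
  set mu := hpe_mu c in mu0 mu1 test3 *.
  have rdist := regularized_zero_dist Mpsd monT mu0 zsP T0.
  have wd : ip (M (hpe_zt i - z0)) (hpe_zt i - z0) <= (drift * d) ^+ 2.
    have := form_chain_le Mpsd (hpe_zt i) zs z0.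
    have := form_chain_le Mpsd (hpe_zt i) (hpe_zprev c) zs.
    rewrite (form_sym Mpsd zs z0) (form_sym Mpsd (hpe_zt i) (hpe_zprev c)).
    rewrite (form_sym Mpsd (hpe_zprev c) zs).
    have {}pp : ip (M (hpe_zprev c - hpe_zt i)) (hpe_zprev c - hpe_zt i) <=
        (1 + kappa) / (1 - sigma) * d ^+ 2.
      rewrite mulrAC ler_pdivlMr ?subr_gt0// mulrC; exact: le_trans eE.
    have {}dp := le_trans dp eE; rewrite /energy_bound in dp.
    have := ler_wpM2r (sqr_ge0 d) drift_sqr; rewrite exprMn.
    have := sqr_ge0 d; move: rdist; move: (d ^+ 2) pp dp => D2 pp dp.
    lra.
  have dd0 : 0 <= mu * (drift * d) by rewrite !mulr_ge0 ?drift_ge0 ?(ltW mu0).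
  have far : rho < 2 * (mu * (drift * d)).
    rewrite -(@ltr_pXn2r _ 2) ?nnegrE ?(ltW rho0)//; last exact: mulr_ge0.
    have := form_sum_le Mpsd (hpe_zprev c - hpe_z i) (- (mu *: (hpe_zt i - z0))).
    rewrite formNZ//.
    move: test2; rewrite /hpe_test2 seminorm_le// expr_div_n => test2.
    have := ler_wpM2l (sqr_ge0 mu) wd; move: test3; rewrite /hpe_v -/mu.
    rewrite !exprMn; lra.
  have -> : 2 / (mu / 2) = 4 / mu by field; rewrite gt_eqF.
  rewrite ler_pdivrMr// /mu_range mulrDl.
  have : 4 <= 8 * drift * d / rho * mu.
    rewrite -!mulrA (mulrC rho^-1) !mulrA ler_pdivlMr//; nra.
  lra.
move=> _; exists ((1 - rate * hpe_mu c) * e).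
  split=> //=; last by exists zs.
  by rewrite mulr_ge0 ?subr_ge0 ?(ltW rmu1)//= (le_trans _ eE)// ler_piMl//; lra.
apply: potential_inner_step => //.
move: ntest2; rewrite /hpe_test2 seminorm_le// -ltNge => big.
have := form_chain_le Mpsd (hpe_zprev c) zs (hpe_z i).
rewrite (form_sym Mpsd _ zs).
have : (1 - rate * hpe_mu c) * e <= e by rewrite ler_piMl//; lra.
by move: big; rewrite exprMn; nra.
Qed.

Lemma hpe_terminates c s : execution (dr_hpe ip T M z0 eta0 sigma tau rho) c s ->
  exists N : nat, stops_at (dr_hpe ip T M z0 eta0 sigma tau rho) c s N /\
    N%:R <= potential 1 energy_bound.
Proof.
move=> [c0 exec].
set a := dr_hpe _ _ _ _ _ _ _ _ in c0 exec *.
have inv i : (forall j : nat, (j < i)%N -> ~~ stop a (c j) (s j)) ->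
    exists2 e, energy_invariant (c i) e &
      potential (hpe_mu (c i)) e + i%:R <= potential 1 energy_bound.
  elim: i => [_|i IH run].
    rewrite c0 /=; exists energy_bound; last by rewrite addr0.
    apply: restart_invariant; first by rewrite ltr01 lexx.
    rewrite divr1 /mu_range lerDl divr_ge0 ?(ltW rho0)// !mulr_ge0//.
    exact: drift_ge0.
  have runi j : (j < i)%N -> ~~ stop a (c j) (s j) by move=> /ltnW; apply: run.
  have [e inve le_e] := IH runi; have [stepi nexti] := exec i runi.
  have nstop := run i (ltnSn i); rewrite (nexti nstop).
  have [e' inve' le_e'] := potential_step inve stepi nstop.
  by exists e' => //; rewrite -natr1; lra.
have bnd i : (forall j : nat, (j < i)%N -> ~~ stop a (c j) (s j)) ->
    i%:R <= potential 1 energy_bound.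
  by move=> /inv[e inve]; have := potential_ge0 inve; lra.
have [|N stopN minN] := @ex_minnP (fun i => stop a (c i) (s i)).
  apply: contrapT => nostop.
  have run j : ~~ stop a (c j) (s j).
    by apply/negP => stopj; apply: nostop; exists j.
  have := bnd (Num.truncn (potential 1 energy_bound)).+1 (fun j _ => run j).
  by rewrite leNgt truncnS_gt.
have run j : (j < N)%N -> ~~ stop a (c j) (s j).
  by apply: contraTN => /minN; rewrite -leqNgt.
by exists N; split; [|exact: bnd].
Qed.

End HPEComplexity.

(** * A bound uniform in the data *)

Section UniformBound.
Context {R : realType}.

Lemma excess_scale_le (A d rho : R) : 1 <= A -> 0 <= d -> 0 < rho ->
  excess rho (A * d ^+ 2) <= ln (expR 1 * (16 * A)) + 2 * logplus (d / rho).
Proof.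
move=> A1 d0 rho0; have A0 : 0 < 16 * A by lra.
have e1 : 0 < expR 1 :> R by exact: expR_gt0.
have K1 : 1 <= expR 1 * (16 * A).
  rewrite -[1 in leLHS]mulr1 ler_pM//; last by lra.
  by have := @expR_ge1Dx R 1; lra.
have lnK : 0 <= ln (expR 1 * (16 * A)) by rewrite ln_ge0.
have lp0 : 0 <= logplus (d / rho) by rewrite /logplus le_max lexx orbT.
rewrite /excess ge_max; apply/andP; split; last by lra.
have [->|d_neq0] := eqVneq d 0.
  rewrite expr0n /= !(mulr0, mul0r) ln0//.
  by apply: addr_ge0 => //; rewrite mulr_ge0// /logplus le_max lexx orbT.
have dr : 0 < d / rho by rewrite divr_gt0// lt0r d_neq0.
have -> : expR 1 * (16 * (A * d ^+ 2) / rho ^+ 2) =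
    expR 1 * (16 * A) * (d / rho) ^+ 2 by rewrite expr_div_n; ring.
rewrite lnM ?posrE ?exprn_gt0 ?(mulr_gt0 e1 A0)// lerD2l lnXn// mulr_natl.
by rewrite lerMn2r /logplus le_max lexx.
Qed.

(** The complexity of the framework, when eta0 is at most a fixed multiple
    kappa of the squared distance to the zeros.  The constant is the product of
    the coefficients bounding cycle_cost and mu_range. *)
Theorem dr_hpe_complexity (sigma tau kappa : R) :
  0 <= sigma < 1 -> 0 < tau < 1 -> 0 <= kappa ->
  exists2 C : R, 0 < C &
  forall (V : vectType R) (ip : {dot V for (@idfun R)}) (T : V -> set V)
    (M : V -> V) (z0 : V) (eta0 rho : R),
    hpe_admissible ip T M eta0 sigma tau rho ->
    (forall mu, 0 < mu -> zeros (regularize T mu M z0) !=set0) ->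
    let d := dist_zeros ip T M z0 in
    eta0 <= kappa * d ^+ 2 ->
    forall c s, execution (dr_hpe ip T M z0 eta0 sigma tau rho) c s ->
    exists N : nat, stops_at (dr_hpe ip T M z0 eta0 sigma tau rho) c s N /\
      N.+1%:R <= C * ((1 + d / rho) * (1 + logplus (d / rho))).
Proof.
move=> /andP[s0 s1] /andP[t0 t1] k0.
have r0 : 0 < rate sigma tau by rewrite lt_min t0 divr_gt0 ?subr_gt0.
have D0 : 0 <= drift sigma kappa.
  have : 0 <= (1 + kappa) / (1 - sigma) by rewrite divr_ge0 ?subr_ge0 ?(ltW s1)//; lra.
  by rewrite /drift; lra.
pose a := ln (expR 1 * (16 * (1 + kappa))) : R.
have a0 : 0 <= a.
  apply: ln_ge0; rewrite -[leLHS]mulr1 ler_pM//; last by lra.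
  by have := @expR_ge1Dx R 1; lra.
pose w := 1 + (a + 2) / rate sigma tau; pose h := 2 + 8 * drift sigma kappa.
have w0 : 1 <= w by rewrite /w lerDl divr_ge0 ?(ltW r0)//; lra.
have h0 : 2 <= h by rewrite /h lerDl mulr_ge0.
exists (w * h); first by rewrite mulr_gt0//; lra.
move=> V ip T M z0 eta0 rho adm reg d eta0_le c s exec.
have rho0 : 0 < rho by case: adm.
have T0 : zeros T !=set0 by case: adm.
have [N [stopN Nle]] := hpe_terminates adm reg k0 eta0_le exec.
exists N; split=> //.
have d_ge0 : 0 <= d by exact: dist_zeros_ge0.
have dr : 0 <= d / rho by rewrite divr_ge0// ltW.
have lp : 0 <= logplus (d / rho) by rewrite /logplus le_max lexx orbT.
set W := cycle_cost ip T M z0 sigma tau rho kappa.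
have Wle : W <= w * (1 + logplus (d / rho)).
  rewrite /W /cycle_cost /energy_bound -/d.
  have : excess rho ((1 + kappa) * d ^+ 2) / rate sigma tau <=
      (a + 2) / rate sigma tau * (1 + logplus (d / rho)).
    rewrite mulrAC ler_pM2r ?invr_gt0//.
    by apply: le_trans (excess_scale_le _ _ _) _ => //; rewrite -/a; nra.
  by rewrite /w; lra.
have W1 : 1 <= W by exact: cycle_cost_ge1 adm.
have Gle : mu_range ip T M z0 sigma rho kappa <= h * (1 + d / rho).
  by rewrite /mu_range -/d /h; have := mulr_ge0 D0 dr; lra.
have : N.+1%:R <= W * mu_range ip T M z0 sigma rho kappa.
  rewrite -natr1; move: Nle; rewrite /potential mulr1 divr1 -/W.
  have -> : excess rho (energy_bound ip T M z0 kappa) / rate sigma tau = W - 1.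
    by rewrite /W /cycle_cost addrC addKr.
  by lra.
move=> /le_trans; apply.
have -> : w * h * ((1 + d / rho) * (1 + logplus (d / rho))) =
  (w * (1 + logplus (d / rho))) * (h * (1 + d / rho)) by ring.
rewrite ler_pM//; first by lra.
rewrite /mu_range addr_ge0 ?divr_ge0 ?mulr_ge0 ?(ltW rho0)//.
Qed.

End UniformBound.

(** * The scalar inequalities behind the error criterion *)

Section QuadraticForm.
Context {R : realType}.

(** A form that is nonnegative on pairs of numbers is nonnegative on pairs of
    vectors, coordinate by coordinate. *)
Lemma quad_form_vec k (a b c : R) (u v : 'cV[R]_k) :
  (forall x y, 0 <= a * x ^+ 2 + 2 * b * (x * y) + c * y ^+ 2) ->
  0 <= a * dotv u u + 2 * b * dotv u v + c * dotv v v.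
Proof.
move=> H; rewrite !dotvE !mulr_sumr -!big_split /=; apply: sumr_ge0 => i _.
by have := H (u i 0) (v i 0); rewrite !expr2.
Qed.

Variables alpha theta tau sigma : R.

Definition pair_form (x y : R) : R :=
  ((1 - tau) * (sigma * (1 + theta) - 1)
     + alpha * (theta * sigma - tau * (sigma + theta + sigma * theta - 1)))
    * x ^+ 2
  + 2 * ((sigma + theta - 1) * (1 - theta)) * (x * y)
  + (sigma - (1 - theta) ^+ 2) * y ^+ 2.

(** The part of admissibility on which the error criterion rests.  Being free of
    the equation that determines sigma from tau, it can be met by perturbing
    (tau, sigma) = (0, 1). *)
Record relaxation_pair : Prop := RelaxationPair {
  relax_tau : 0 < tau < 1;
  relax_sigma : 0 <= sigma < 1;
  relax_slack : tau * (sigma + theta - 1 + theta * sigma) <= theta * sigma;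
  relax_form : forall x y, 0 <= pair_form x y }.

Lemma pair_G_form x y :
  let u : 'cV[R]_2 := \col_i (if i == 0 then x else y) in
  dotv (pair_G alpha theta tau sigma *m u) u = pair_form x y.
Proof.
rewrite /= dotvE !big_ord_recl big_ord0 !mxE !big_ord_recl !big_ord0 !mxE /=.
by rewrite /pair_form; ring.
Qed.

Lemma admissible_relaxation : 1 <= theta ->
  admissible_pair alpha theta tau sigma -> relaxation_pair.
Proof.
move=> th1 [/andP[t0 t12] _ _ _ /andP[s0 s1]]; rewrite !ge_max => /and3P[_ smax _].
case=> _ Gpsd; split.
- by apply/andP; split; lra.
- by apply/andP; split; lra.
- have den : 0 < (1 - tau) * theta - tau by nra.
  by move: smax; rewrite ler_pdivrMr//; lra.
- by move=> x y; rewrite -pair_G_form; apply: Gpsd.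
Qed.

Hypothesis pairP : relaxation_pair.
Hypothesis th1 : 1 <= theta.
Local Notation E := (sigma + theta - 1).
Local Notation e := (E / (1 - tau)).
Local Notation G22 := (sigma - (1 - theta) ^+ 2).

Lemma relax_G22 : 0 <= G22.
Proof. by have := relax_form pairP 0 1; rewrite /pair_form; lra. Qed.

Lemma relax_G11 : 0 <= (1 - tau) * (sigma * (1 + theta) - 1)
  + alpha * (theta * sigma - tau * (sigma + theta + sigma * theta - 1)).
Proof. by have := relax_form pairP 1 0; rewrite /pair_form; lra. Qed.

Lemma relax_e : (1 - tau) * e = E.
Proof.
by rewrite mulrC divfK// gt_eqF// subr_gt0; case/andP: (relax_tau pairP).
Qed.

Lemma relax_E_ge0 : 0 <= E.
Proof. by have /andP[s0 _] := relax_sigma pairP; have := th1; lra. Qed.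

Lemma relax_e_ge0 : 0 <= e.
Proof.
by rewrite divr_ge0 ?relax_E_ge0// subr_ge0 ltW//; case/andP: (relax_tau pairP).
Qed.

Lemma relax_e_le : e <= E + theta * sigma.
Proof.
have /andP[_ t1] := relax_tau pairP.
by rewrite ler_pdivrMr ?subr_gt0//; have := relax_slack pairP; lra.
Qed.

(* the coefficient of |a|^2 in theta / beta times the slack of the criterion *)
Local Notation K := (sigma * (1 + theta) - 1 + alpha * theta * sigma).

(** Nonnegativity of the first diagonal entry of G amounts to
    K - e alpha >= - E alpha, and relax_slack to theta sigma - e >= - E: so E
    times the estimate of the first step is enough. *)
Lemma first_gap (beta ww wa aa s dd : R) : 0 < beta -> theta < 2 ->
  0 <= aa -> 0 <= s ->
  alpha * beta * aa + s <= 2 * beta * wa + 4 * theta / (2 - theta) * dd ->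
  beta * (G22 * ww + e * alpha * aa) + e * s <=
  beta * (G22 * ww + 2 * E * wa + K * aa) + theta * sigma * s
    + theta * (4 * E * dd / (2 - theta)).
Proof.
move=> be0 th2 aa0 s0 gap.
have /andP[_ t1] := relax_tau pairP.
have H1 : E * (alpha * beta * aa + s) <=
    E * (2 * beta * wa + 4 * theta / (2 - theta) * dd).
  by rewrite ler_wpM2l// relax_E_ge0.
have H2 : e * s <= (E + theta * sigma) * s by rewrite ler_wpM2r// relax_e_le.
have H3 : e * alpha <= E * alpha + K.
  rewrite mulrAC ler_pdivrMr ?subr_gt0//; have := relax_G11; lra.
have H4 : beta * (e * alpha * aa) <= beta * ((E * alpha + K) * aa).
  by rewrite ler_wpM2l ?(ltW be0)// ler_wpM2r.
lra.
Qed.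

(** The coupling bound is multiplied by E.  The choice (1 - tau) e = E then
    cancels the terms of the previous a and s, and (1 - tau) times the rest is
    the form of G at a and (1 - tau) w'. *)
Lemma next_gap k (beta s s' : R) (w w' a a' : 'cV[R]_k) : 0 < beta -> 0 <= s ->
  2 * beta * (1 - theta) * dotv w' a + alpha * beta * (dotv a a - dotv a' a')
    + (s - s') <= 2 * beta * dotv w a ->
  beta * (G22 * dotv w w + e * alpha * dotv a a) + e * s <=
  beta * (G22 * dotv w w + 2 * E * dotv w a + K * dotv a a) + theta * sigma * s
    + (1 - tau) * (beta * (G22 * dotv w' w' + e * alpha * dotv a' a') + e * s').
Proof.
move=> be0 s0 coupling.
have /andP[_ t1] := relax_tau pairP.
have H2 : e * s <= (E + theta * sigma) * s by rewrite ler_wpM2r// relax_e_le.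
have H1 := ler_wpM2l relax_E_ge0 coupling.
have hE x : (1 - tau) * e * x = E * x by rewrite relax_e.
have := quad_form_vec a ((1 - tau) *: w') (relax_form pairP).
rewrite !dotvs (dotvC a w'); move: e hE H2 => e' hE H2 form.
have H0 : 0 <= (E * alpha + K - e' * alpha) * dotv a a
    + 2 * (E * (1 - theta)) * dotv w' a + (1 - tau) * G22 * dotv w' w'.
  have t10 : 0 < 1 - tau by rewrite subr_gt0.
  by rewrite -(pmulr_rge0 _ t10); have := hE (alpha * dotv a a); lra.
have := mulr_ge0 (ltW be0) H0.
have := hE (beta * alpha * dotv a' a'); have := hE s'; lra.
Qed.

End QuadraticForm.

(** D0 and D1 are the squared distances of z0 and z1 to a zero of the
    regularized operator.  With - 2 <w, a> <= |a|^2 + |w|^2 the descent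
    inequality gives D1 <= D0 + (theta - 1) beta |w|^2, and theta beta |w|^2 is
    at most 2 (D0 + D1); hence (2 - theta) (D0 + D1) <= 2 theta D0, which is
    where theta < 2 enters. *)
Lemma first_step_estimate (R : realType)
    (alpha beta theta D0 D1 ww wa aa x s dd : R) :
  0 <= alpha -> 0 < beta -> 1 <= theta < 2 -> 0 <= aa -> 0 <= ww -> 0 <= x ->
  0 <= s -> 0 <= D1 -> D0 <= dd -> - (aa + ww) <= 2 * wa ->
  D1 + x + (1 + alpha) * beta * aa + s + beta * (2 - theta) * ww
    + 2 * beta * wa <= D0 ->
  x + (1 + alpha) * beta * aa + s + beta * theta * ww <= 2 * (D0 + D1) ->
  alpha * beta * aa + s <= 2 * beta * wa + 4 * theta / (2 - theta) * dd.
Proof.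
move=> al0 be0 /andP[th1 th2] aa0 ww0 x0 s0 D10 Dd wa_ge desc chain.
have bwa : - (beta * aa + beta * ww) <= 2 * beta * wa.
  by have := ler_wpM2l (ltW be0) wa_ge; lra.
have baa : 0 <= beta * aa by rewrite mulr_ge0// ltW.
have bww : 0 <= beta * ww by rewrite mulr_ge0// ltW.
have abaa : 0 <= alpha * (beta * aa) by rewrite mulr_ge0.
have tww : 0 <= (theta - 1) * (beta * ww) by rewrite mulr_ge0// subr_ge0.
have D1le : (2 - theta) * D1 <= (3 * theta - 2) * D0.
  have : theta * D1 <= theta * (D0 + (theta - 1) * (beta * ww)).
    by rewrite ler_wpM2l//; lra.
  have : (theta - 1) * (theta * (beta * ww)) <= (theta - 1) * (2 * (D0 + D1)).
    by rewrite ler_wpM2l//; lra.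
  lra.
have DD : D0 + D1 <= 2 * theta / (2 - theta) * D0.
  by rewrite mulrAC ler_pdivlMr ?subr_gt0//; lra.
have : 2 * theta / (2 - theta) * D0 <= 2 * theta / (2 - theta) * dd.
  by rewrite ler_wpM2l// divr_ge0//; lra.
lra.
Qed.

(** * The error criterion along the ADMM *)

Section ErrorCriterion.
Context {R : realType} {n p m : nat}.
Variables (P : problem R n p m) (D : parameters R n p m).
Hypothesis hyp : standing_assumptions P D.

Local Notation A := (mat_A P).
Local Notation B := (mat_B P).
Local Notation x0 := (par_x0 D).
Local Notation y0 := (par_y0 D).
Local Notation gamma0 := (par_gamma0 D).
Local Notation beta := (par_beta D).
Local Notation theta := (par_theta D).
Local Notation rho := (par_rho D).
Local Notation alpha := (par_alpha D).
Local Notation MR := (par_R D).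
Local Notation MS := (par_S D).
Local Notation Q := (opQ P D).
Local Notation ip := (ipZ R n p m).

Implicit Types (c : admm_config R n p m) (i : admm_iterate R n p m).

Let be0 : 0 < beta. Proof. by case: hyp. Qed.
Let th0 : 0 < theta. Proof. by case: hyp. Qed.
Let al0 : 0 <= alpha. Proof. by case: hyp. Qed.
Let Rpsd : mxpsd MR. Proof. by case: hyp. Qed.
Let Spsd : mxpsd MS. Proof. by case: hyp. Qed.
Let be_neq0 : beta != 0. Proof. by rewrite gt_eqF. Qed.
Let th_neq0 : theta != 0. Proof. by rewrite gt_eqF. Qed.
Let Qpsd : selfadjoint_psd ip Q. Proof. exact: selfadjoint_psd_opQ. Qed.
Let monT : Defs.monotone ip (opT P). Proof. exact: monotone_opT. Qed.

(** The vector a of the introduction. *)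
Definition primal_gap c i : 'cV[R]_m := B *m admm_dy c i.
Definition x_gap c i : R := dotv (MR *m admm_dx c i) (admm_dx c i).
Definition y_gap c i : R := dotv (MS *m admm_dy c i) (admm_dy c i).

Lemma x_gap_ge0 c i : 0 <= x_gap c i. Proof. exact: Rpsd.2. Qed.
Lemma y_gap_ge0 c i : 0 <= y_gap c i. Proof. exact: Spsd.2. Qed.

Local Notation ww c i := (dotv (dual_gap D c i) (dual_gap D c i)).
Local Notation wa c i := (dotv (dual_gap D c i) (primal_gap c i)).
Local Notation aa c i := (dotv (primal_gap c i) (primal_gap c i)).

Definition zprev c : Zspace R n p m :=
  (admm_xprev c, admm_yprev c, admm_gammaprev c).
Definition znext i : Zspace R n p m := (admm_x i, admm_y i, admm_gamma i).
Definition ztilde i : Zspace R n p m := (admm_x i, admm_y i, admm_gammat i).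

Section OneStep.
Variables (c : admm_config R n p m) (i : admm_iterate R n p m).
Hypothesis mu_gt0 : 0 < admm_mu c.
Hypothesis stepci : admm_step P D c i.

Lemma form_next_tilde : ip (Q (znext i - ztilde i)) (znext i - ztilde i) =
  beta / theta * ((1 - theta) ^+ 2 * ww c i + 2 * (1 - theta) * wa c i + aa c i).
Proof.
rewrite opQ_form /= !subrr !mulmx0 !dotv0l mulr0 !add0r.
rewrite (admm_gamma_gammat hyp mu_gt0 stepci) -/(primal_gap c i).
move: (dual_gap D c i) (primal_gap c i) => w a.
by rewrite !dotvs (dotvC a); field; rewrite be_neq0 th_neq0.
Qed.

Lemma form_prev_tilde : ip (Q (zprev c - ztilde i)) (zprev c - ztilde i) =
  x_gap c i + (1 + alpha) * beta * aa c i + y_gap c i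
  + beta / theta * (ww c i + 2 * wa c i + aa c i).
Proof.
rewrite opQ_form /= -/(primal_gap c i) -/(x_gap c i) -/(y_gap c i).
rewrite (admm_gammat_prev hyp mu_gt0 stepci) -/(primal_gap c i).
move: (dual_gap D c i) (primal_gap c i) => w a.
by rewrite !dotvs (dotvC a); field; rewrite be_neq0 th_neq0.
Qed.

Lemma form_prev_next : ip (Q (zprev c - znext i)) (zprev c - znext i) =
  x_gap c i + (1 + alpha) * beta * aa c i + y_gap c i
  + beta * theta * ww c i.
Proof.
rewrite opQ_form /= -/(primal_gap c i) -/(x_gap c i) -/(y_gap c i).
rewrite /dual_gap /admm_dgamma; move: (admm_gammaprev c - _) => v.
by rewrite !dotvs; field; rewrite be_neq0 th_neq0.
Qed.

Definition error_criterion (sigma tau etap eta : R) : Prop :=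
  ip (Q (znext i - ztilde i)) (znext i - ztilde i) + eta <=
  sigma * ip (Q (zprev c - ztilde i)) (zprev c - ztilde i) + (1 - tau) * etap.

(** The criterion multiplied by theta and written in w and a; the term
    sigma theta x_gap on its larger side is dropped. *)
Lemma error_criterion_gap sigma tau etap eta : 0 <= sigma ->
  theta * eta <= beta * ((sigma - (1 - theta) ^+ 2) * ww c i
      + 2 * (sigma + theta - 1) * wa c i
      + (sigma * (1 + theta) - 1 + alpha * theta * sigma) * aa c i)
    + theta * sigma * y_gap c i + theta * ((1 - tau) * etap) ->
  error_criterion sigma tau etap eta.
Proof.
move=> s0 H; rewrite /error_criterion form_next_tilde form_prev_tilde.
rewrite -(ler_pM2l th0); have := mulr_ge0 (mulr_ge0 (ltW th0) s0) (x_gap_ge0 c i).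
set u := theta * (beta / theta * _ + eta).
have -> : u = beta * ((1 - theta) ^+ 2 * ww c i + 2 * (1 - theta) * wa c i + aa c i)
   + theta * eta by rewrite /u; field.
set v := theta * (sigma * _ + _).
have -> : v = theta * sigma * (x_gap c i + (1 + alpha) * beta * aa c i + y_gap c i)
  + sigma * beta * (ww c i + 2 * wa c i + aa c i) + theta * ((1 - tau) * etap).
  by rewrite /v; field.
move: H; lra.
Qed.

(** For this sigma the quadratic form in w and a is a multiple of
    |w + theta a|^2 up to a nonnegative multiple of |a|^2. *)
Lemma error_criterion_contraction tau :
  error_criterion (theta + (theta - 1) ^+ 2) tau 0 0.
Proof.
apply: error_criterion_gap.
  by rewrite addr_ge0 ?sqr_ge0// ltW.
have := y_gap_ge0 c i; move: (dual_gap D c i) (primal_gap c i) => w a yg.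
have [aa0 sq] := (dotv_ge0 a, dotv_ge0 (w + theta *: a)).
rewrite !mulr0 addr0 addr_ge0//; last first.
  by rewrite !mulr_ge0// ?addr_ge0 ?sqr_ge0 ?(ltW th0).
rewrite mulr_ge0 ?(ltW be0)//; set sg := theta + _.
have -> : (sg - (1 - theta) ^+ 2) * dotv w w + 2 * (sg + theta - 1) * dotv w a
    + (sg * (1 + theta) - 1 + alpha * theta * sg) * dotv a a
  = theta * dotv (w + theta *: a) (w + theta *: a)
    + alpha * theta * sg * dotv a a.
  by rewrite !dotvs (dotvC a) /sg; ring.
by rewrite addr_ge0 ?mulr_ge0 ?addr_ge0 ?sqr_ge0 ?(ltW th0).
Qed.

Lemma first_step_gap (theta_bounds : 1 <= theta < 2) :
  admm_xprev c = x0 -> admm_yprev c = y0 -> admm_gammaprev c = gamma0 ->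
  alpha * beta * aa c i + y_gap c i
    <= 2 * beta * wa c i + 4 * theta / (2 - theta) * d0 P D ^+ 2.
Proof.
move=> cx cy cg; have zpE : zprev c = startZ D by rewrite /zprev cx cy cg.
have [cf cg' sol _ _ _ _ _ _ reg] := hyp; have [zs zsP] := reg _ mu_gt0.
have zsd : ip (Q (startZ D - zs)) (startZ D - zs) <= d0 P D ^+ 2.
  apply: (regularized_zero_dist Qpsd monT mu_gt0 zsP).
  exact: zeros_opT_neq0.
have desc := hpe_descent Qpsd monT zsP (z := znext i) (zp := zprev c)
  (admm_inclusion hyp mu_gt0 stepci).
have chain := form_chain_le Qpsd (zprev c) zs (znext i).
have zt0 : 0 <= ip (Q (ztilde i - zs)) (ztilde i - zs) by case: Qpsd.
have D1 : 0 <= ip (Q (zs - znext i)) (zs - znext i) by case: Qpsd.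
have muzt := mulr_ge0 (ltW mu_gt0) zt0.
move: desc chain; rewrite -/(ztilde i) form_next_tilde form_prev_tilde form_prev_next.
rewrite (form_sym Qpsd zs (zprev c)) zpE => desc chain.
apply: (first_step_estimate (D0 := ip (Q (startZ D - zs)) (startZ D - zs))
  (D1 := ip (Q (zs - znext i)) (zs - znext i)) (ww := ww c i) (x := x_gap c i)) => //.
- exact: dotv_ge0.
- exact: dotv_ge0.
- exact: x_gap_ge0.
- exact: y_gap_ge0.
- have := dotv_ge0 (dual_gap D c i + primal_gap c i).
  move: (dual_gap D c i) (primal_gap c i) => w a.
  by rewrite !dotvs (dotvC a); lra.
- move: desc muzt; set X := ip _ _; set mu := admm_mu c => desc muzt.
  have id1 : beta / theta * ((1 - theta) ^+ 2 * ww c i + 2 * (1 - theta) * wa c i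
     + aa c i) = beta / theta * (ww c i + 2 * wa c i + aa c i)
     - beta * (2 - theta) * ww c i - 2 * beta * wa c i by field.
  by rewrite id1 in desc; lra.
- by lra.
Qed.

End OneStep.

Section Coupling.
Variables (c c' : admm_config R n p m) (i i' : admm_iterate R n p m).
Hypothesis mu_gt0 : 0 < admm_mu c.
Hypothesis stepci : admm_step P D c i.
Hypothesis c'E : c' = AdmmConfig (admm_mu c) (admm_x i) (admm_y i) (admm_gamma i).
Hypothesis stepci' : admm_step P D c' i'.

(** Monotonicity of the subdifferential of g between y_k and y_{k-1}, with both
    inclusions in the form of admm_y_subdiff; the mu-terms have the right sign
    because mu is the same at both iterations. *)
Lemma coupling :
  2 * beta * (1 - theta) * dotv (dual_gap D c i) (primal_gap c' i')
    + alpha * beta * (aa c' i' - aa c i) + (y_gap c' i' - y_gap c i)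
  <= 2 * beta * wa c' i'.
Proof.
have mu'E : admm_mu c' = admm_mu c by rewrite c'E.
have mu'0 : 0 < admm_mu c' by rewrite mu'E.
have := subdiff_monotone (admm_y_subdiff hyp mu'0 stepci')
                         (admm_y_subdiff hyp mu_gt0 stepci).
have dyE : admm_dy c' i' = - (admm_y i' - admm_y i) by rewrite c'E opprB.
have gapE : admm_gammat i' - admm_gammat i =
    beta *: ((1 - theta) *: dual_gap D c i + primal_gap c i)
    - beta *: (dual_gap D c' i' + primal_gap c' i').
  have <- := admm_gammat_prev hyp mu'0 stepci'.
  have <- := admm_gamma_gammat hyp mu_gt0 stepci.
  by rewrite c'E /= opprB [RHS]addrC addrA subrK.
have vyE : admm_vy D c' i' - admm_vy D c i =
    (1 + admm_mu c) *: admm_dy c' i' - admm_dy c i.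
  rewrite /admm_vy mu'E dyE; move: (admm_dy c i) => dy.
  by apply/matrixP => j k; rewrite !mxE; ring.
have -> : admm_y i' - admm_y i = - admm_dy c' i' by rewrite dyE opprK.
set MQ := _ + MS.
have -> : B^T *m admm_gammat i' + MQ *m admm_vy D c' i'
   - (B^T *m admm_gammat i + MQ *m admm_vy D c i) =
   B^T *m (admm_gammat i' - admm_gammat i)
   + MQ *m (admm_vy D c' i' - admm_vy D c i).
  by rewrite !mulmxBr opprD addrACA.
rewrite gapE vyE dotvNl dotvDr -dotv_mulmx -/(primal_gap c' i').
have MQE u v : dotv u (MQ *m v) =
    (1 + alpha) * beta * dotv (B *m u) (B *m v) + dotv (MS *m u) v.
  rewrite /MQ mulmxDl -scalemxAl -mulmxA dotvDr dotvZr -dotv_mulmx.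
  by rewrite dotvC [dotv u _]dotvC (mxpsdC _ _ Spsd).
have gapB : B *m ((1 + admm_mu c) *: admm_dy c' i' - admm_dy c i) =
    (1 + admm_mu c) *: primal_gap c' i' - primal_gap c i.
  by rewrite mulmxBr -scalemxAr.
rewrite MQE gapB -/(primal_gap c' i').
have := mulr_ge0 (ltW mu_gt0) (y_gap_ge0 c' i').
have := mulr_ge0 (ltW mu_gt0) (mulr_ge0 (ltW be0) (dotv_ge0 (primal_gap c' i'))).
have := Spsd.2 (admm_dy c' i' - admm_dy c i).
have := dotv_ge0 (primal_gap c' i' - primal_gap c i).
rewrite /y_gap; move: (admm_dy c' i') (admm_dy c i) (admm_mu c) => dy' dy mu.
move: (primal_gap c' i') (primal_gap c i) (dual_gap D c' i') (dual_gap D c i).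
move=> a' a w' w Ha HS Ka Ks; rewrite mulmxBr !dotvs in HS *.
have Kaa := mulr_ge0 al0 Ka.
have {}Ha := mulr_ge0 (mulr_ge0 al0 (ltW be0)) Ha; rewrite !dotvs in Ha.
rewrite (mxpsdC dy dy' Spsd) in HS.
rewrite (dotvC a a') in Ha; rewrite (dotvC w) (dotvC w'); lra.
Qed.

End Coupling.

(** Chosen so that the |w|^2-term cancels in the criterion and the terms in the
    previous iterate produced by the coupling are paid by (1 - tau) times the
    previous error. *)
Definition relaxed_eta (tau sigma : R) c i : R :=
  (beta * ((sigma - (1 - theta) ^+ 2) * ww c i
     + (sigma + theta - 1) / (1 - tau) * alpha * aa c i)
   + (sigma + theta - 1) / (1 - tau) * y_gap c i) / theta.

Section Relaxed.
Variables tau sigma : R.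
Hypothesis pairP : relaxation_pair alpha theta tau sigma.
Hypothesis theta_bounds : 1 <= theta < 2.

Let th1 : 1 <= theta. Proof. by case/andP: theta_bounds. Qed.
Let th2 : theta < 2. Proof. by case/andP: theta_bounds. Qed.
Let sigma0 : 0 <= sigma. Proof. by case/andP: (relax_sigma pairP). Qed.
Let tau1 : 0 < 1 - tau.
Proof. by rewrite subr_gt0; case/andP: (relax_tau pairP). Qed.

Lemma relaxed_eta_ge0 c i : 0 <= relaxed_eta tau sigma c i.
Proof.
have e_ge0 : 0 <= (sigma + theta - 1) / (1 - tau) by exact: relax_e_ge0 pairP th1.
have G22_ge0 := relax_G22 pairP.
have ww_ge0 := dotv_ge0 (dual_gap D c i); have aa_ge0 := dotv_ge0 (primal_gap c i).
apply: divr_ge0 (ltW th0); apply: addr_ge0; last exact: mulr_ge0 (y_gap_ge0 c i).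
apply: mulr_ge0 (ltW be0) _; apply: addr_ge0; first exact: mulr_ge0.
by apply: mulr_ge0 => //; apply: mulr_ge0.
Qed.

Lemma relaxed_etaE c i : theta * relaxed_eta tau sigma c i =
  beta * ((sigma - (1 - theta) ^+ 2) * ww c i
     + (sigma + theta - 1) / (1 - tau) * alpha * aa c i)
   + (sigma + theta - 1) / (1 - tau) * y_gap c i.
Proof. by rewrite mulrC divfK. Qed.

Lemma relaxed_first_criterion mu i :
  let c := AdmmConfig mu x0 y0 gamma0 in
  0 < mu -> admm_step P D c i ->
  error_criterion c i sigma tau
    (4 * (sigma + theta - 1) * d0 P D ^+ 2 / ((2 - theta) * (1 - tau)))
    (relaxed_eta tau sigma c i).
Proof.
move=> c mu0 stepci; apply: error_criterion_gap => //; rewrite relaxed_etaE.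
have -> : (1 - tau) *
    (4 * (sigma + theta - 1) * d0 P D ^+ 2 / ((2 - theta) * (1 - tau))) =
    4 * (sigma + theta - 1) * d0 P D ^+ 2 / (2 - theta).
  by field; rewrite !gt_eqF// subr_gt0.
apply: first_gap => //; first exact: dotv_ge0.
  exact: y_gap_ge0.
exact: (first_step_gap (c := c)).
Qed.

Lemma relaxed_next_criterion c i i' :
  let c' := AdmmConfig (admm_mu c) (admm_x i) (admm_y i) (admm_gamma i) in
  0 < admm_mu c -> admm_step P D c i -> admm_step P D c' i' ->
  error_criterion c' i' sigma tau
    (relaxed_eta tau sigma c i) (relaxed_eta tau sigma c' i').
Proof.
move=> c' mu0 stepci stepci'; apply: error_criterion_gap => //.
rewrite (mulrCA theta (1 - tau)) !relaxed_etaE.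
apply: next_gap => //; first exact: y_gap_ge0.
exact: (coupling mu0 stepci (erefl c') stepci').
Qed.

End Relaxed.

Lemma admm_mu_gt0 (c : nat -> admm_config R n p m)
    (s : nat -> admm_iterate R n p m) k : execution (dr_admm P D) c s ->
  (forall j : nat, (j < k)%N -> ~~ stop (dr_admm P D) (c j) (s j)) ->
  0 < admm_mu (c k).
Proof.
move=> [c0 exec]; elim: k => [_|k IH run]; first by rewrite c0 /=.
have runk j : (j < k)%N -> ~~ stop (dr_admm P D) (c j) (s j).
  by move=> /ltnW; apply: run.
have [_ nextk] := exec k runk; have := IH runk.
rewrite (nextk (run k (ltnSn k))) /= /admm_next.
by case: ifP => //= _ mu0; rewrite divr_gt0.
Qed.

(** Each iteration either starts a cycle at z_0 or follows an iteration of the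
    same cycle; these are the two cases to check. *)
Lemma dr_admm_instance tau sigma eta0
    (eta : admm_config R n p m -> admm_iterate R n p m -> R) :
  0 < tau < 1 -> 0 <= sigma < 1 -> 0 <= eta0 -> (forall c i, 0 <= eta c i) ->
  (forall mu i, let c := AdmmConfig mu x0 y0 gamma0 in
    0 < mu -> admm_step P D c i -> error_criterion c i sigma tau eta0 (eta c i)) ->
  (forall c i i',
    let c' := AdmmConfig (admm_mu c) (admm_x i) (admm_y i) (admm_gamma i) in
    0 < admm_mu c -> admm_step P D c i -> admm_step P D c' i' ->
    error_criterion c' i' sigma tau (eta c i) (eta c' i')) ->
  instance_of_dr_hpe P D tau sigma eta0.
Proof.
move=> tau01 sigma01 eta0_ge0 eta_ge0 first_ok next_ok.
have [cf cg sol _ _ rho0 _ _ _ _] := hyp.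
have test3E c i ep e : admm_test3 P D c i =
    hpe_test2 ip Q rho (hpe_config_of c ep) (hpe_iterate_of i e).
  by rewrite /admm_test3 -(seminorm_opQ hyp).
have test4E c i ep e : admm_test4 P D c i =
    hpe_test3 ip Q (startZ D) rho (hpe_config_of c ep) (hpe_iterate_of i e).
  by rewrite /admm_test4 -(seminorm_opQ hyp).
split=> [|c s [c0 exec]|c i ep e]; last by split.
  by split=> //; [exact: maximal_monotone_opT|exact: zeros_opT_neq0].
pose etap k := if k is j.+1 then
  (if admm_test3 P D (c j) (s j) then eta0 else eta (c j) (s j)) else eta0.
exists etap, (fun k => eta (c k) (s k)).
have mu_pos k := @admm_mu_gt0 c s k (conj c0 exec).
have okk k : (forall j : nat, (j < k)%N -> ~~ stop (dr_admm P D) (c j) (s j)) ->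
    admm_step P D (c k) (s k) ->
    error_criterion (c k) (s k) sigma tau (etap k) (eta (c k) (s k)).
  case: k => [_|k run]; first by rewrite c0 /=; apply: first_ok.
  have runk j : (j < k)%N -> ~~ stop (dr_admm P D) (c j) (s j).
    by move=> /ltnW; apply: run.
  have muk := mu_pos k runk; have [stepk nextk] := exec k runk.
  rewrite (nextk (run k (ltnSn k))) /= /admm_next.
  case: ifPn => _ /=; last exact: next_ok.
  by apply: first_ok; rewrite divr_gt0.
split=> [|k run]; first by rewrite /= /hpe_config_of c0.
have runa j : (j < k)%N -> ~~ stop (dr_admm P D) (c j) (s j).
  move=> /run; rewrite /= (test3E _ _ (etap j) (eta (c j) (s j))).
  by rewrite (test4E _ _ (etap j) (eta (c j) (s j))).
have muk := mu_pos k runa; have [stepk nextk] := exec k runa.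
split.
  split; [exact: admm_inclusion|exact: eta_ge0|].
  rewrite !(seminorm_sqr Qpsd); exact: okk runa stepk.
move=> nstop; rewrite nextk; last first.
  rewrite /= (test3E _ _ (etap k) (eta (c k) (s k))).
  by rewrite (test4E _ _ (etap k) (eta (c k) (s k))).
rewrite /= /admm_next /hpe_next -test3E /hpe_config_of /=.
by case: ifP.
Qed.

End ErrorCriterion.

(** * Existence of parameters for theta at least 1 *)

Section PairExistence.
Context {R : realType}.
Implicit Types alpha theta tau sigma : R.

Lemma theta_sup_lt alpha theta : 0 <= alpha -> 1 <= theta ->
  theta < theta_sup alpha ->
  theta < 2 /\ 0 < 1 + 2 * alpha + theta * (1 - alpha) - theta ^+ 2.
Proof.
move=> al0 th1; rewrite /theta_sup ltr_pdivlMr// -ltrBlDl => th_lt.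
set r := alpha ^+ 2 + 6 * alpha + 5 in th_lt.
have r0 : 0 <= r by rewrite /r addr_ge0// addr_ge0 ?sqr_ge0// mulr_ge0.
have s2 : Num.sqrt r ^+ 2 = r by rewrite sqr_sqrtr.
have s0 : 0 <= Num.sqrt r by exact: sqrtr_ge0.
have s3 : Num.sqrt r < 3 + alpha.
  by rewrite -(@ltr_pXn2r _ 2) ?nnegrE ?addr_ge0// s2 /r; lra.
split; first by lra.
have l0 : 0 <= theta * 2 - (1 - alpha) by lra.
have : (theta * 2 - (1 - alpha)) ^+ 2 < Num.sqrt r ^+ 2.
  by rewrite ltr_pXn2r// nnegrE.
by rewrite s2 /r; lra.
Qed.

(** The pair (e, 1 - e) for small e > 0: at e = 0 the second diagonal entry of
    G is theta (2 - theta) and its determinant is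
    theta^2 (1 + 2 alpha + theta (1 - alpha) - theta^2), both positive below
    theta_sup, and they are polynomials in e. *)
Lemma relaxation_pair_exists alpha theta : 0 <= alpha -> 1 <= theta ->
  theta < theta_sup alpha -> exists tau sigma, relaxation_pair alpha theta tau sigma.
Proof.
move=> al0 th1 /(theta_sup_lt al0 th1)[th2 det0].
pose a : {poly R} := (1 - 'X) * ((1 - 'X) * (1 + theta%:P) - 1)
  + alpha%:P * (theta%:P * (1 - 'X)
     - 'X * (1 - 'X + theta%:P + (1 - 'X) * theta%:P - 1)).
pose b : {poly R} := (1 - 'X + theta%:P - 1) * (1 - theta%:P).
pose g : {poly R} := 1 - 'X - ((1 - theta) ^+ 2)%:P.
have near_gt0 (q : {poly R}) : 0 < q.[0] -> \forall e \near 0^'+, 0 < q.[e].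
  have : horner q x @[x --> 0^'+] --> q.[0].
    by apply: cvg_at_right_filter; exact: continuous_horner.
  by move=> /cvgr_gt; apply.
have g0 : 0 < g.[0].
  have : 0 < theta * (2 - theta) by rewrite mulr_gt0//; lra.
  by rewrite /g !hornerE; lra.
have D0 : 0 < (a * g - b * b).[0].
  rewrite /a /g /b !hornerE.
  have th0 : 0 < theta ^+ 2 by rewrite exprn_gt0//; lra.
  by rewrite /=; have := mulr_gt0 th0 det0; lra.
have [e [[[e0 e1] ge] De]] : exists e, ((0 < e /\ e < 4^-1) /\ 0 < g.[e]) /\
    0 < (a * g - b * b).[e].
  apply: (@filter_ex _ (at_right (0 : R))); near=> e; split; first split.
  - split; first by near: e; exact: nbhs_right_gt.
    by near: e; apply: nbhs_right_lt; rewrite invr_gt0.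
  - by near: e; exact: near_gt0.
  - by near: e; exact: near_gt0.
exists e, (1 - e); split.
- by apply/andP; split; lra.
- by apply/andP; split; lra.
- nra.
(* multiplied by G22, the form is a square plus det G times x^2 *)
move=> x y; rewrite -(pmulr_rge0 _ ge).
move: ge De; rewrite /a /b /g !hornerE /= => ge De.
rewrite /pair_form; set G11 := (X in X * x ^+ 2).
have := mulr_ge0 (ltW De) (sqr_ge0 x).
set G12 := (1 - e + theta - 1) * (1 - theta); set G22 := 1 - e - (1 - theta) ^+ 2.
have := sqr_ge0 (G12 * x + G22 * y); rewrite /G11 /G12 /G22; lra.
Unshelve. all: by end_near.
Qed.

End PairExistence.

(** * Conclusion *)

Section Termination.
Context {R : realType} {n p m : nat}.
Variables (P : problem R n p m) (D : parameters R n p m).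
Hypothesis hyp : standing_assumptions P D.

Lemma dr_admm_terminates (C tau sigma eta0 : R) c s :
  instance_of_dr_hpe P D tau sigma eta0 ->
  (forall c s,
    execution (dr_hpe (ipZ R n p m) (opT P) (opQ P D) (startZ D) eta0 sigma tau
      (par_rho D)) c s ->
    exists N : nat,
      stops_at (dr_hpe (ipZ R n p m) (opT P) (opQ P D) (startZ D) eta0 sigma tau
        (par_rho D)) c s N /\
      N.+1%:R <= C * ((1 + d0 P D / par_rho D)
                      * (1 + logplus (d0 P D / par_rho D)))) ->
  execution (dr_admm P D) c s ->
  exists N : nat,
    let vx := admm_vx D (c N) (s N) in
    let vy := admm_vy D (c N) (s N) in
    let vgamma := admm_vgamma D (c N) (s N) in
    [/\ stops_at (dr_admm P D) c s N,
        N.+1%:R <= C * ((1 + d0 P D / par_rho D)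
                        * (1 + logplus (d0 P D / par_rho D))),
        opT P (admm_x (s N), admm_y (s N), admm_gammat (s N))
          (opQ P D (vx, vy, vgamma)) &
        seminorm (ipZ R n p m) (opQ P D) (vx, vy, vgamma) <= par_rho D].
Proof.
move=> [_ run_hpe tests] hpeN exec.
have [etap [eta /hpeN[N [[stopN runN] Nle]]]] := run_hpe c s exec.
have stopE j : stop (dr_admm P D) (c j) (s j) =
    hpe_test2 (ipZ R n p m) (opQ P D) (par_rho D)
      (hpe_config_of (c j) (etap j)) (hpe_iterate_of (s j) (eta j)) &&
    hpe_test3 (ipZ R n p m) (opQ P D) (startZ D) (par_rho D)
      (hpe_config_of (c j) (etap j)) (hpe_iterate_of (s j) (eta j)).
  by have [t3 _ t4] := tests (c j) (s j) (etap j) (eta j); rewrite /= t3 t4.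
have run j : (j < N)%N -> ~~ stop (dr_admm P D) (c j) (s j).
  by rewrite stopE; exact: runN.
have stopP : stop (dr_admm P D) (c N) (s N) by rewrite stopE; exact: stopN.
exists N; split=> //.
  apply: admm_opT => //; first exact: admm_mu_gt0 exec run.
  by have [stepN _] := exec.2 N run.
by rewrite seminorm_opQ//; case/andP: stopP.
Qed.

Lemma instance_small_theta : par_theta D < 1 -> forall tau, 0 < tau < 1 ->
  instance_of_dr_hpe P D tau (par_theta D + (par_theta D - 1) ^+ 2) 0.
Proof.
move=> th1 tau tau01; have th0 : 0 < par_theta D by case: hyp.
apply: (dr_admm_instance hyp (eta := fun _ _ => 0)) => //.
- by rewrite addr_ge0 ?sqr_ge0 ?(ltW th0)//=; nra.
- by move=> mu i c mu0 stepi; apply: error_criterion_contraction.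
- by move=> c i i' c' mu0 _ stepi; apply: error_criterion_contraction.
Qed.

Lemma instance_large_theta tau sigma : 1 <= par_theta D < 2 ->
  relaxation_pair (par_alpha D) (par_theta D) tau sigma ->
  instance_of_dr_hpe P D tau sigma
    (4 * (sigma + par_theta D - 1) * d0 P D ^+ 2
       / ((2 - par_theta D) * (1 - tau))).
Proof.
move=> /[dup] th12 /andP[th1 th2] pairP.
have := relax_E_ge0 pairP th1; have := relax_tau pairP => /andP[t0 t1] E0.
apply: (dr_admm_instance hyp (eta := relaxed_eta P D tau sigma)).
- exact: relax_tau pairP.
- exact: relax_sigma pairP.
- apply: divr_ge0; apply: mulr_ge0; rewrite ?sqr_ge0 ?mulr_ge0//.
  + by rewrite subr_ge0 ltW.
  + by rewrite subr_ge0 ltW.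
- by move=> c i; apply: relaxed_eta_ge0.
- by move=> mu i c mu0 stepi; apply: relaxed_first_criterion.
- by move=> c i i' c' mu0 stepi stepi'; apply: relaxed_next_criterion.
Qed.

End Termination.

Theorem theorem3p5 (R : realType) (alpha theta : R)
    (halpha : 0 <= alpha) (htheta : 0 < theta < theta_sup alpha) :
  exists2 C : R, 0 < C &
  forall (n p m : nat) (P : problem R n p m) (D : parameters R n p m),
    par_alpha D = alpha -> par_theta D = theta ->
    standing_assumptions P D ->
    [/\ theta < 1 -> forall tau : R, 0 < tau < 1 ->
          instance_of_dr_hpe P D tau (theta + (theta - 1) ^+ 2) 0,
        1 <= theta -> forall taub sigmab : R,
          admissible_pair alpha theta taub sigmab ->
          instance_of_dr_hpe P D taub sigmab
            (4 * (sigmab + theta - 1) * d0 P D ^+ 2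
               / ((2 - theta) * (1 - taub))) &
        forall c s, execution (dr_admm P D) c s ->
          exists N : nat,
            let vx := admm_vx D (c N) (s N) in
            let vy := admm_vy D (c N) (s N) in
            let vgamma := admm_vgamma D (c N) (s N) in
            [/\ stops_at (dr_admm P D) c s N,
                N.+1%:R <= C * ((1 + d0 P D / par_rho D)
                                * (1 + logplus (d0 P D / par_rho D))),
                opT P (admm_x (s N), admm_y (s N), admm_gammat (s N))
                  (opQ P D (vx, vy, vgamma)) &
                seminorm (ipZ R n p m) (opQ P D) (vx, vy, vgamma) <= par_rho D]].
Proof.
have [th0 thsup] := andP htheta.
have part2 n p m (P : problem R n p m) (D : parameters R n p m) :
    par_alpha D = alpha -> par_theta D = theta -> standing_assumptions P D ->
    1 <= theta -> forall tau sigma, relaxation_pair alpha theta tau sigma ->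
    instance_of_dr_hpe P D tau sigma
      (4 * (sigma + theta - 1) * d0 P D ^+ 2 / ((2 - theta) * (1 - tau))).
  move=> alE thE hyp th1 tau sigma; rewrite -thE -alE; apply: instance_large_theta => //.
  by rewrite thE th1; have [] := theta_sup_lt halpha th1 thsup.
have [C C0 CP] : exists2 C : R, 0 < C &
    forall n p m (P : problem R n p m) (D : parameters R n p m),
    par_alpha D = alpha -> par_theta D = theta -> standing_assumptions P D ->
    exists tau sigma eta0, instance_of_dr_hpe P D tau sigma eta0 /\
    (forall c s,
    execution (dr_hpe (ipZ R n p m) (opT P) (opQ P D) (startZ D) eta0 sigma tau
      (par_rho D)) c s ->
    exists N : nat,
      stops_at (dr_hpe (ipZ R n p m) (opT P) (opQ P D) (startZ D) eta0 sigma tau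
        (par_rho D)) c s N /\
      N.+1%:R <= C * ((1 + d0 P D / par_rho D)
                      * (1 + logplus (d0 P D / par_rho D)))).
  have [th1|th1] := ltP theta 1.
    have s01 : 0 <= theta + (theta - 1) ^+ 2 < 1.
      by rewrite addr_ge0 ?sqr_ge0 ?(ltW th0)//=; nra.
    have t01 : 0 < (2^-1 : R) < 1 by apply/andP; split; lra.
    have [C C0 CP] := dr_hpe_complexity s01 t01 (lexx 0).
    exists C => // n p m P D alE thE hyp.
    exists 2^-1, (theta + (theta - 1) ^+ 2), 0.
    have inst : instance_of_dr_hpe P D 2^-1 (theta + (theta - 1) ^+ 2) 0.
      by rewrite -thE; apply: instance_small_theta; rewrite ?thE.
    split=> //; have [adm _ _] := inst.
    have [_ _ _ _ _ _ _ _ _ reg] := hyp.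
    by apply: CP => //; rewrite mul0r.
  have [tau [sigma pairP]] := relaxation_pair_exists halpha th1 thsup.
  have [th2 _] := theta_sup_lt halpha th1 thsup.
  have [s01 t01] := (relax_sigma pairP, relax_tau pairP).
  have k0 : 0 <= 4 * (sigma + theta - 1) / ((2 - theta) * (1 - tau)).
    have t1 : tau <= 1 by case/andP: t01 => _ /ltW.
    have := relax_E_ge0 pairP th1; rewrite subr_ge0 => E0.
    by rewrite divr_ge0 ?mulr_ge0 ?subr_ge0 ?(ltW th2).
  have [C C0 CP] := dr_hpe_complexity s01 t01 k0.
  exists C => // n p m P D alE thE hyp.
  exists tau, sigma.
  exists (4 * (sigma + theta - 1) * d0 P D ^+ 2 / ((2 - theta) * (1 - tau))).
  have inst := part2 _ _ _ P D alE thE hyp th1 tau sigma pairP.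
  split=> //; have [adm _ _] := inst.
  have [_ _ _ _ _ _ _ _ _ reg] := hyp.
  by apply: CP => //; rewrite [leRHS]mulrAC.
exists C => // n p m P D alE thE hyp; split.
- by move=> th1 tau tau01; rewrite -thE; apply: instance_small_theta; rewrite ?thE.
- move=> th1 tau sigma /(admissible_relaxation th1); exact: part2.
- have [tau [sigma [eta0 [inst runs]]]] := CP n p m P D alE thE hyp.
  by move=> c s exec; apply: dr_admm_terminates inst runs exec.
Qed.
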